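(* Suppose $u_0>0$, $p>1$ and $\alpha\in(0,1)$. Then the solution $u$ of the initial value problem $$ D^\alpha u(t)=u^p(t)\ \text{ for } t>0,\qquad u(0)=u_0, $$ blows up in finite time $T_m<\infty$.
   Context: $D^\alpha$, $\alpha\in(0,1)$, is the Liouville-Caputo fractional derivative $D^\alpha h(t)=\frac{d}{dt}\frac{1}{\Gamma(1-\alpha)}\int_0^t(t-s)^{-\alpha}[h(s)-h(0)]\,ds$, with $\Gamma$ the Gamma function. A solution of the initial value problem is equivalently a solution of the integral equation $u(t)=u(0)+\frac{1}{\Gamma(\alpha)}\int_0^t(t-s)^{\alpha-1}u^p(s)\,ds$, $t\ge0$. Blow-up at the finite time $T_m$ means $\lim_{t\to T_m,\,t<T_m}u(t)=\infty$. *)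

(* Defs.v *)
From HB Require Import structures.
From mathcomp Require Import all_boot all_order all_algebra.
From mathcomp Require Import all_classical all_reals all_analysis.

Set Implicit Arguments.
Unset Strict Implicit.
Unset Printing Implicit Defensive.

Import Order.TTheory GRing.Theory Num.Theory.
Import numFieldNormedType.Exports.

Local Open Scope classical_set_scope.
Local Open Scope ring_scope.

(* Euler's integral; only meaningful for 0 < a, where it is finite. *)
Definition Gamma (R : realType) (a : R) : R :=
  \int[@lebesgue_measure R]_(x in `]0, +oo[) (x `^ (a - 1) * expR (- x)).

(* The integrand takes the junk value 0 at the single point s = t, where
   [0 `^ (- alpha) = 0]; this does not affect the integral. *)
Definition caputo_primitive (R : realType) (alpha : R) (h : R -> R) (t : R) : R :=
  (Gamma (1 - alpha))^-1 *
  \int[@lebesgue_measure R]_(s in `[0, t]) ((t - s) `^ (- alpha) * (h s - h 0)).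

(* [derive1] is total: the value is meaningful only at points where
   [caputo_primitive alpha h] is derivable. *)
Definition caputo (R : realType) (alpha : R) (h : R -> R) : R -> R :=
  derive1 (caputo_primitive alpha h).

(* [u] is a solution on [0, T) with 0 < T <= +oo; its values outside [0, T)
   are irrelevant. Real powers only make sense on nonnegative numbers ([powR]
   takes a junk value elsewhere), whence the condition [0 <= u t]. *)
Definition is_solution (R : realType) (alpha p u0 : R) (T : \bar R)
    (u : R -> R) : Prop :=
  [/\ (0 < T)%E,
      {within [set t : R | 0 <= t /\ (t%:E < T)%E], continuous u},
      (forall t : R, 0 <= t -> (t%:E < T)%E -> 0 <= u t),
      u 0 = u0 &
      forall t : R, 0 < t -> (t%:E < T)%E ->
        derivable (caputo_primitive alpha u) t 1 /\
        caputo alpha u t = u t `^ p].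

Definition is_maximal_solution (R : realType) (alpha p u0 : R) (T : \bar R)
    (u : R -> R) : Prop :=
  is_solution alpha p u0 T u /\
  forall (S : \bar R) (v : R -> R), (T < S)%E ->
    (forall t : R, 0 <= t -> (t%:E < T)%E -> v t = u t) ->
    ~ is_solution alpha p u0 S v.

(* [u], on [0, T), is the solution of the initial value problem: the only
   maximal one. Functions are compared on [0, T) only. *)
Definition is_the_solution (R : realType) (alpha p u0 : R) (T : \bar R)
    (u : R -> R) : Prop :=
  is_maximal_solution alpha p u0 T u /\
  forall (S : \bar R) (v : R -> R), is_maximal_solution alpha p u0 S v ->
    S = T /\ forall t : R, 0 <= t -> (t%:E < T)%E -> v t = u t.

(* Main.v *)
(* The Caputo problem is equivalent to the Volterra equation
   u = u0 + c (k_al * u ^ p), where k_a(x) = x ^ (a - 1) on x > 0 and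
   c = Gamma (1 - al) / B(1 - al, al): one direction is
   k_(1 - al) * k_al = B(1 - al, al) k_1 together with the fundamental theorem
   of calculus; for the other one, a solution v is nonnegative, so that the
   equation for k_(1 - al) * v involves nonnegative functions only and may be
   convolved with k_al and differentiated.
   Picard iteration from 0 increases to a [0, +oo]-valued minimal solution of
   the Volterra equation, nondecreasing in time. It is +oo at a finite time:
   u (t + h) >= c' h ^ al u(t) ^ p, so u doubles after a waiting time
   proportional to u ^ (- (p - 1) / al), and these times form a convergent
   geometric series. It cannot stay bounded up to its blow-up time, because
   a bounded solution is prolonged by a constant supersolution. Every solution
   dominates the iterates, and equals their supremum by a Gronwall argument. *)

(* The obstacle is that the Caputo primitive integrates [u s - u 0], whose sign is unknown at first,
   and that a solution is bounded only on compact subintervals of its domain. Convolutions are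
   therefore [\bar R]-valued integrals over the whole line of nonnegative functions, usually zero at
   negative times: Tonelli gives associativity outright and the value +oo is allowed. A solution is
   cut off at a real horizon [T] inside its domain, and negative terms move to the other side of an
   equation before anything is convolved. The constant c is chosen so that c B(1 - al, al) = Gamma
   (1 - al), which makes the factors cancel; of Gamma itself only positivity is established.
   Starting the iteration from 0 puts the minimal solution below every supersolution. This serves
   twice: against a constant prolongation, and against an arbitrary solution. As the minimal
   solution is defined at all times, possibly as +oo, one object yields existence, the maximal
   interval and the blow-up: Tm is the supremum of the times where it is finite. Its continuity
   before Tm comes from a Hoelder estimate for fractional integrals of bounded functions. *)
Require Import Defs.
From HB Require Import structures.
From mathcomp Require Import all_boot all_order all_algebra.
From mathcomp Require Import all_classical all_reals all_analysis.
From mathcomp Require Import measurable_realfun ring lra.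

Import Order.TTheory GRing.Theory Num.Theory.
Import numFieldNormedType.Exports.

Local Open Scope classical_set_scope.
Local Open Scope ring_scope.

Set Implicit Arguments.
Unset Strict Implicit.
Unset Printing Implicit Defensive.

(** * Convolution of nonnegative functions *)

(* Locked: otherwise unification compares convolutions by unfolding integrals. *)
HB.lock Definition conv (R : realType) (f g : R -> \bar R) (t : R) : \bar R :=
  (\int[@lebesgue_measure R]_s (f (t - s)%R * g s))%E.

Section convolution.
Context {R : realType}.
Local Open Scope ereal_scope.
Notation mu := (@lebesgue_measure R).
Implicit Types (f g h : R -> \bar R) (s t c : R).

(** The image of Lebesgue measure under [s |-> t - s] gives every interval []a, b]] its length, and
    this characterizes Lebesgue measure. *)
Lemma ge0_integral_reflect f t : measurable_fun [set: R] f ->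
  (forall x, 0 <= f x) ->
  \int[mu]_s f (t - s)%R = \int[mu]_s f s.
Proof.
move=> mf f0.
have mr : measurable_fun setT
    (fun s : measurableTypeR R => (t - s)%R : measurableTypeR R).
  exact: measurable_funB.
have H (A : set (measurableTypeR R)) : measurable A ->
    pushforward mu
      (fun s : measurableTypeR R => (t - s)%R : measurableTypeR R) A = mu A.
  move=> mA; apply/esym/lebesgue_measure_unique => //= _ [[a b]] _ <-.
  rewrite /pushforward/=.
  have -> : (fun s => (t - s)%R) @^-1` `]a, b] = `[(t - b)%R, (t - a)%R[%classic.
    by apply/seteqP; split=> x /=; rewrite !in_itv/=; lra.
  rewrite !lebesgue_measure_itv/= !lte_fin -!EFinD.
  have -> : (t - b < t - a)%R = (a < b)%R by lra.
  by case: ifP => // _; congr EFin; ring.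
have := @ge0_integral_pushforward _ _ _ _ _ _ mr mu setT
  (f : measurableTypeR R -> \bar R) measurableT mf (fun x _ => f0 x).
rewrite preimage_setT => <-.
by apply: eq_measure_integral => A mA _; exact: H.
Qed.

(** A translation is the composite of two reflections. *)
Lemma ge0_integral_translate f t : measurable_fun [set: R] f ->
  (forall x, 0 <= f x) ->
  \int[mu]_s f (s - t)%R = \int[mu]_s f s.
Proof.
move=> mf f0.
rewrite -(@ge0_integral_reflect f (- t)%R)//.
rewrite -[RHS](@ge0_integral_reflect _ 0%R)//.
- by apply: eq_integral => s _; congr f; ring.
- by apply: measurableT_comp => //; exact: measurable_funB.
Qed.

(** Same principle as for reflections: [c] times the image measure under [s |-> c * s] has the right
    value on intervals. *)
Lemma ge0_integral_scale f c : (0 < c)%R -> measurable_fun [set: R] f ->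
  (forall x, 0 <= f x) -> \int[mu]_s f (c * s)%R = c^-1%:E * \int[mu]_s f s.
Proof.
move=> c0 mf f0.
have mr : measurable_fun setT
    (fun s : measurableTypeR R => (c * s)%R : measurableTypeR R).
  exact: measurable_funM.
pose nu0 : {measure set (measurableTypeR R) -> \bar R} :=
  mscale (NngNum (ltW c0)) (pushforward mu
    (fun s : measurableTypeR R => (c * s)%R : measurableTypeR R)).
pose nu := nu0 mr.
have H (A : set (measurableTypeR R)) : measurable A -> nu A = mu A.
  move=> mA; apply/esym/lebesgue_measure_unique => //= _ [[a b]] _ <-.
  rewrite /nu/nu0/= /mscale /pushforward/=.
  have E : (fun s => (c * s)%R) @^-1` `]a, b] = `](c^-1 * a)%R, (c^-1 * b)%R]%classic.
    apply/seteqP; split=> x /=; rewrite !in_itv/=;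
    by rewrite ltr_pdivrMl// ler_pdivlMl.
  rewrite [X in _ = _ * lebesgue_stieltjes_measure _ X]E.
  have -> : lebesgue_stieltjes_measure idfun `](c^-1 * a)%R, (c^-1 * b)%R] =
      mu `](c^-1 * a)%R, (c^-1 * b)%R] by [].
  rewrite !lebesgue_measure_itv/= !lte_fin ltr_pM2l ?invr_gt0// -!EFinD.
  case: ifP => // _; last by rewrite mule0.
  by rewrite -EFinM; congr EFin; field; rewrite gt_eqF.
have mr' := @ge0_integral_pushforward _ _ _ _ _ _ mr mu setT
  (f : measurableTypeR R -> \bar R) measurableT mf (fun x _ => f0 x).
rewrite preimage_setT in mr'; rewrite -mr'.
rewrite -(@eq_measure_integral _ _ _ setT mu nu
  (f : measurableTypeR R -> \bar R)); last first.
  by move=> A mA _; exact: H.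
rewrite ge0_integral_mscale// muleA -EFinM mulVf ?gt_eqF// mul1e.
by [].
Qed.

Lemma convE f g t : conv f g t = \int[mu]_s (f (t - s)%R * g s).
Proof. by rewrite conv.unlock. Qed.

Lemma measurable_conv2 f g :
  measurable_fun [set: R] f -> measurable_fun [set: R] g ->
  measurable_fun [set: R * R] (fun z : R * R => f (z.1 - z.2)%R * g z.2).
Proof.
move=> mf mg; apply: emeasurable_funM.
- by apply: measurableT_comp => //; exact: measurable_funB.
- exact: measurableT_comp.
Qed.

Lemma measurable_conv1 f g t :
  measurable_fun [set: R] f -> measurable_fun [set: R] g ->
  measurable_fun [set: R] (fun s => f (t - s)%R * g s).
Proof.
move=> mf mg; apply: emeasurable_funM => //.
by apply: measurableT_comp => //; exact: measurable_funB.
Qed.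

Lemma measurable_conv f g :
  measurable_fun [set: R] f -> measurable_fun [set: R] g ->
  (forall x, 0 <= f x) -> (forall x, 0 <= g x) ->
  measurable_fun [set: R] (conv f g).
Proof.
move=> mf mg f0 g0.
rewrite (_ : conv f g = fun t => \int[mu]_s (f (t - s)%R * g s)); last first.
  by apply/funext => t; rewrite convE.
apply: (@measurable_fun_fubini_tonelli_F _ _ _ _ _ mu
  (fun z : R * R => f (z.1 - z.2)%R * g z.2)).
- exact: measurable_conv2.
- by move=> z; rewrite mule_ge0.
Qed.

Lemma conv_ge0 f g t : (forall x, 0 <= f x) -> (forall x, 0 <= g x) ->
  0 <= conv f g t.
Proof. by move=> f0 g0; rewrite convE; apply: integral_ge0 => s _; rewrite mule_ge0. Qed.

Lemma convC f g : measurable_fun [set: R] f -> measurable_fun [set: R] g ->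
  (forall x, 0 <= f x) -> (forall x, 0 <= g x) -> conv f g = conv g f.
Proof.
move=> mf mg f0 g0; apply/funext => t.
rewrite !convE -(@ge0_integral_reflect _ t); first last.
- by move=> x; rewrite mule_ge0.
- exact: measurable_conv1.
by apply: eq_integral => s _; rewrite muleC; congr (g _ * f _); ring.
Qed.

(** Tonelli exchanges the two integrals; translating the inner variable by [r] then turns
    [g (s - r)] into [g s]. *)
Lemma convA f g h : measurable_fun [set: R] f -> measurable_fun [set: R] g ->
  measurable_fun [set: R] h ->
  (forall x, 0 <= f x) -> (forall x, 0 <= g x) -> (forall x, 0 <= h x) ->
  conv f (conv g h) = conv (conv f g) h.
Proof.
move=> mf mg mh f0 g0 h0; apply/funext => t; rewrite !convE.
transitivity (\int[mu]_s \int[mu]_r (f (t - s)%R * (g (s - r)%R * h r))).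
  apply: eq_integral => s _; rewrite convE ge0_integralZl//.
  - exact: measurable_conv1.
  - by move=> r _; rewrite mule_ge0.
rewrite (@fubini_tonelli _ _ _ _ _ mu mu
  (fun z : R * R => f (t - z.1)%R * (g (z.1 - z.2)%R * h z.2)))/=; first last.
- by move=> z; rewrite !mule_ge0.
- apply: emeasurable_funM; last exact: measurable_conv2.
  by apply: measurableT_comp => //; exact: measurable_funB.
apply: eq_integral => r _.
have mfg : measurable_fun [set: R] (fun s => f (t - r - s)%R * g s).
  exact: measurable_conv1.
rewrite convE -ge0_integralZr//; last by move=> s _; rewrite mule_ge0.
rewrite -(@ge0_integral_translate (fun s => f (t - r - s)%R * g s * h r) r).
- by apply: eq_integral => s _; rewrite muleA; congr (f _ * _ * _); ring.
- exact: emeasurable_funM.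
- by move=> s; rewrite !mule_ge0.
Qed.

Lemma eq_conv f g g' t :
  (forall x, f (t - x)%R != 0 -> g x = g' x) -> conv f g t = conv f g' t.
Proof.
move=> gg'; rewrite !convE; apply: eq_integral => s _.
by have [->|fs] := eqVneq (f (t - s)%R) 0; [rewrite !mul0e|rewrite gg'].
Qed.

Lemma convDr f g g' t :
  measurable_fun [set: R] f -> measurable_fun [set: R] g ->
  measurable_fun [set: R] g' ->
  (forall x, 0 <= f x) -> (forall x, 0 <= g x) -> (forall x, 0 <= g' x) ->
  conv f (g \+ g') t = conv f g t + conv f g' t.
Proof.
move=> mf mg mg' f0 g0 g'0; rewrite !convE -ge0_integralD//.
- by apply: eq_integral => s _; rewrite ge0_muleDr.
- by move=> s _; rewrite mule_ge0.
- exact: measurable_conv1.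
- by move=> s _; rewrite mule_ge0.
- exact: measurable_conv1.
Qed.

Lemma convZr f g (k : R) t :
  measurable_fun [set: R] f -> measurable_fun [set: R] g ->
  (forall x, 0 <= f x) -> (forall x, 0 <= g x) -> (0 <= k)%R ->
  conv f (fun s => k%:E * g s) t = k%:E * conv f g t.
Proof.
move=> mf mg f0 g0 k0; rewrite !convE -ge0_integralZl//.
- by apply: eq_integral => s _; rewrite muleCA.
- exact: measurable_conv1.
- by move=> s _; rewrite mule_ge0.
Qed.

End convolution.

(** * Fractional kernels *)

Section kernel.
Context {R : realType}.
Local Open Scope ereal_scope.
Notation mu := (@lebesgue_measure R).
Implicit Types (f g : R -> \bar R) (a b c s t x : R).

(** A point is Lebesgue-null. The exception absorbs the jump of a step function, and time 0, where
    the minimal solution is set to 0 while a solution equals u0. *)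
Lemma le_conv_except f g g' t x0 : measurable_fun [set: R] f ->
  measurable_fun [set: R] g -> measurable_fun [set: R] g' ->
  (forall x, 0 <= f x) -> (forall x, 0 <= g x) -> (forall x, 0 <= g' x) ->
  (forall x, x != x0 -> 0 < f (t - x)%R -> g x <= g' x) ->
  conv f g t <= conv f g' t.
Proof.
move=> mf mg mg' f0 g0 g'0 gg'.
have m1 := @measurable_conv1 _ f g t mf mg.
have m2 := @measurable_conv1 _ f g' t mf mg'.
rewrite !convE -(@integral_setD1 _ _ x0); [|exact: measurableD|exact: measurable_funTS].
rewrite -[leRHS](@integral_setD1 _ _ x0); [|exact: measurableD|exact: measurable_funTS].
apply: ge0_le_integral; first exact: measurableD.
- by move=> s _; rewrite mule_ge0.
- exact: measurable_funTS.
- exact: measurable_funTS.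
- move=> s [_ /= /eqP sx]; have := f0 (t - s)%R.
  rewrite le_eqVlt => /predU1P[<-|fs]; first by rewrite !mul0e.
  by apply: lee_wpmul2l => //; exact: gg'.
Qed.

Lemma conv_translate f g t c : measurable_fun [set: R] f ->
  measurable_fun [set: R] g ->
  (forall x, 0 <= f x) -> (forall x, 0 <= g x) ->
  conv f (fun s => g (s - c)%R) t = conv f g (t - c).
Proof.
move=> mf mg f0 g0; rewrite !convE -[RHS](@ge0_integral_translate _ _ c).
- by apply: eq_integral => s _; congr (f _ * _); ring.
- exact: measurable_conv1.
- by move=> s; rewrite mule_ge0.
Qed.

(** The Riemann-Liouville kernel without its normalization. The cutoff makes it causal:
    [conv (ker a) f t] depends only on [f] before [t]. *)
Definition ker a x : \bar R := (if (0 < x)%R then (x `^ (a - 1))%R else 0%R)%:E.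

Lemma ker_ge0 a x : 0 <= ker a x.
Proof. by rewrite lee_fin; case: ifP => // _; exact: powR_ge0. Qed.

Lemma kerN a x : (x <= 0)%R -> ker a x = 0.
Proof. by rewrite /ker leNgt => /negbTE ->. Qed.

Lemma kerE a x : (0 < x)%R -> ker a x = (x `^ (a - 1))%:E.
Proof. by rewrite /ker => ->. Qed.

Lemma ker1E x : ker 1 x = (if (0 < x)%R then 1 else 0)%:E.
Proof. by rewrite /ker subrr powRr0. Qed.

Lemma ker_gt0 a x : 0 < ker a x -> (0 < x)%R.
Proof. by rewrite lte_fin; case: ifP => //; rewrite ltxx. Qed.

Lemma ker_neq0 a x : ker a x != 0 -> (0 < x)%R.
Proof. by rewrite /ker; case: ifP => //; rewrite eqxx. Qed.

Lemma measurable_ker a : measurable_fun [set: R] (ker a).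
Proof.
apply/measurable_EFinP; apply: measurable_fun_ifT => //.
exact: measurable_fun_ltr.
Qed.

Hint Resolve ker_ge0 measurable_ker : core.

Lemma ker_scale a c x : (0 < c)%R -> ker a (c * x) = (c `^ (a - 1))%:E * ker a x.
Proof.
move=> c0; rewrite /ker pmulr_rgt0//; case: ifP => x0; last by rewrite mule0.
by rewrite powRM ?ltW.
Qed.

Lemma le_ker a x y : (a <= 1)%R -> (0 < x)%R -> (x <= y)%R -> ker a y <= ker a x.
Proof.
move=> a1 x0 xy; have y0 := lt_le_trans x0 xy; rewrite !kerE// lee_fin.
rewrite -[(a - 1)%R]opprB !powRN lef_pV2 ?posrE ?powR_gt0//.
by rewrite ge0_ler_powR ?nnegrE ?subr_ge0// ltW.
Qed.

Definition beta a b := conv (ker a) (ker b) 1.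

Lemma beta_ge0 a b : 0 <= beta a b.
Proof. exact: conv_ge0. Qed.

Lemma betaC a b : beta a b = beta b a.
Proof. by rewrite /beta convC. Qed.

(** Homogeneity: replacing the variable [s] by [t * s] pulls out [t * t ^ (a - 1) * t ^ (b - 1) = t
    ^ (a + b - 1)] and leaves Euler's Beta integral, the value at time 1. *)
Lemma conv_kerE a b t : conv (ker a) (ker b) t = beta a b * ker (a + b) t.
Proof.
have [t0|t0] := leP t 0%R.
  rewrite (kerN _ t0) mule0 convE integral0_eq// => s _.
  have [s0|s0] := leP s 0%R; first by rewrite (kerN _ s0) mule0.
  by rewrite kerN ?mul0e// lerBlDl addr0 (le_trans t0)// ltW.
have m : measurable_fun [set: R] (fun s => ker a (t - s)%R * ker b s).
  exact: measurable_conv1.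
have := @ge0_integral_scale _ (fun s => ker a (t - s)%R * ker b s) t t0 m
  (fun s => mule_ge0 (ker_ge0 _ _) (ker_ge0 _ _)).
rewrite [in X in _ = X -> _]/= -convE => E.
have -> : conv (ker a) (ker b) t =
    t%:E * \int[mu]_s (ker a (t - t * s)%R * ker b (t * s)%R).
  by rewrite E muleA -EFinM divff ?gt_eqF// mul1e.
have -> : \int[mu]_s (ker a (t - t * s)%R * ker b (t * s)%R) =
    \int[mu]_s ((t `^ (a - 1) * t `^ (b - 1))%:E * (ker a (1 - s)%R * ker b s)).
  apply: eq_integral => s _.
  have -> : (t - t * s = t * (1 - s))%R by ring.
  by rewrite !ker_scale// EFinM muleACA.
rewrite ge0_integralZl_EFin//; last 3 first.
- by move=> s _; rewrite mule_ge0.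
- exact: measurable_conv1.
- by rewrite mulr_ge0// powR_ge0.
rewrite -convE -/(beta a b) kerE// muleA -EFinM muleC; congr (_ * _%:E).
rewrite -{1}[t]powRr1 ?ltW// -!powRD ?(gt_eqF t0) ?implybT//.
by congr powR; ring.
Qed.

(** The primitive [x ^ a / a] bounds the integral of [ker a] over [[1 / (n + 1), 1]] by [1 / a], and
    these intervals increase to []0, 1]]. *)
Lemma beta1_lty a : (0 < a)%R -> beta a 1 < +oo.
Proof.
move=> a0; rewrite betaC /beta.
pose f : measurableTypeR R -> \bar R := ker a.
have -> : conv (ker 1) (ker a) 1 = \int[mu]_(s in `]0%R, 1%R[) f s.
  rewrite convE [RHS]integral_mkcond; apply: eq_integral => s _.
  rewrite patchE mem_setE in_itv/= ker1E subr_gt0.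
  have [s0|s0] := leP s 0%R; first by rewrite (kerN _ s0) mule0.
  by case: ifPn; rewrite ?mul1e ?mul0e.
rewrite integral_itv_bndo_bndc; last first.
  by apply: measurable_funTS; exact: measurable_ker.
pose F (n : nat) : set (measurableTypeR R) := `[n.+1%:R^-1%R, 1%R]%classic.
have -> : `]0%R, 1%R]%classic = \bigcup_n F n.
  apply/seteqP; split=> x /=.
    rewrite in_itv/= => /andP[x0 x1].
    have := ltr_add_invr x0; rewrite /= => -[n]; rewrite add0r => nx.
    by exists n => //; rewrite /F/= in_itv/= x1 ltW.
  move=> [n _]; rewrite /F/= !in_itv/= => /andP[nx ->]; rewrite andbT.
  by rewrite (lt_le_trans _ nx)// invr_gt0.
have /cvg_lim <- // :
    \int[mu]_(x in F i) f x @[i --> \oo] --> \int[mu]_(x in \bigcup_i F i) f x.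
  apply: ge0_nondecreasing_set_cvg_integral.
  - apply/nondecreasing_seqP => n; rewrite subsetEset; apply: subset_itvr.
    by rewrite bnd_simp lef_pV2 ?posrE// ler_nat.
  - by move=> i; exact: measurable_itv.
  - by move=> i; apply: measurable_funTS; exact: measurable_ker.
  - by move=> i x _; exact: ker_ge0.
apply: (@le_lt_trans _ _ (a^-1)%:E); last exact: ltry.
apply: lime_le.
  apply: ereal_nondecreasing_is_cvgn; apply: ge0_nondecreasing_set_nondecreasing_integral.
  - apply/nondecreasing_seqP => n; rewrite subsetEset; apply: subset_itvr.
    by rewrite bnd_simp lef_pV2 ?posrE// ler_nat.
  - by move=> i; exact: measurable_itv.
  - by move=> i; apply: measurable_funTS; exact: measurable_ker.
  - by move=> i x _; exact: ker_ge0.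
apply: nearW => n; rewrite /F.
have n0 : (0 < n.+1%:R^-1 :> R)%R by rewrite invr_gt0.
(* For [n = 0] the interval is the single point 1, which the fundamental theorem of calculus does
   not cover. *)
have [n1|n1] := leP 1%R (n.+1%:R^-1 : R)%R.
  have : `[n.+1%:R^-1%R, 1%R] `<=` [set 1%R : R].
    by move=> x/=; rewrite in_itv/= => /andP[h1 h2]; apply/eqP; rewrite eq_le h2 (le_trans n1).
  by move=> /integral_Sset1 ->; rewrite lee_fin invr_ge0 ltW.
have -> : \int[mu]_(x in `[n.+1%:R^-1%R, 1%R]) f x =
    \int[mu]_(x in `[n.+1%:R^-1%R, 1%R]) (x `^ (a - 1))%:E.
  apply: eq_integral => x; rewrite inE/= in_itv/= => /andP[nx _].
  by rewrite /f kerE// (lt_le_trans _ nx).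
have D x : (0 < x)%R -> is_derive x 1%R (fun x => a^-1 * x `^ a)%R (x `^ (a - 1))%R.
  move=> x0; have := @is_derive1_powR _ a x x0 => dx.
  apply: (is_derive_eq (@is_deriveZ _ _ _ _ _ _ _ _ _)).
  by rewrite -[_ *: _]/(_ * _)%R mulrA mulVf ?gt_eqF// mul1r.
have C x : (0 < x)%R -> {for x, continuous (fun x : R => a^-1 * x `^ a)%R}.
  move=> x0; apply: differentiable_continuous; apply/derivable1_diffP.
  by have [] := D x x0.
have C' x : (0 < x)%R -> {for x, continuous (fun x : R => x `^ (a - 1))%R}.
  move=> x0; apply: differentiable_continuous; apply/derivable1_diffP.
  by have [] := @is_derive1_powR _ (a - 1) x x0.
rewrite (@continuous_FTC2 _ _ (fun x => a^-1 * x `^ a)%R)//.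
- rewrite powR1 mulr1 -EFinB lee_fin lerBlDr lerDl mulr_ge0 ?powR_ge0//.
  by rewrite invr_ge0 ltW.
- apply: continuous_in_subspaceT => x; rewrite inE/= in_itv/= => /andP[nx _].
  by apply: C'; rewrite (lt_le_trans n0).
- split.
  + move=> x; rewrite in_itv/= => /andP[nx _].
    by have [] := D x (lt_trans n0 nx).
  + by apply: cvg_at_right_filter; exact: C.
  + by apply: cvg_at_left_filter; exact: C.
- move=> x; rewrite in_itv/= => /andP[nx _].
  by rewrite derive1E; have [_ ->] := D x (lt_trans n0 nx).
Qed.

(** The two singularities are separated at 1/2: on either half the other factor is at most
    [2 ^ (1 - a)] or [2 ^ (1 - b)], hence at most 2, so the integrand is below twice the sum of
    those of [beta a 1] and [beta 1 b]. *)
Lemma beta_lty a b : (0 < a)%R -> (a <= 1)%R -> (0 < b)%R -> (b <= 1)%R ->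
  beta a b < +oo.
Proof.
move=> a0 a1 b0 b1.
have half c x : (0 < c <= 1)%R -> (2^-1 <= x)%R -> ker c x <= 2%:E.
  move=> /andP[c0 c1] hx; apply: (@le_trans _ _ (ker c 2^-1)); first exact: le_ker.
  rewrite kerE// lee_fin -powR_inv1// -powRrM.
  rewrite -[leRHS]powRr1//; apply: ler_powR; lra.
rewrite /beta convE.
apply: (@le_lt_trans _ _ (\int[mu]_s (2%:E * (ker a (1 - s)%R * ker 1 s) +
    2%:E * (ker 1 (1 - s)%R * ker b s)))).
  apply: ge0_le_integral => //.
  - by move=> s _; rewrite mule_ge0.
  - exact: measurable_conv1.
  - apply: emeasurable_funD; apply: emeasurable_funM => //;
    exact: measurable_conv1.
  - move=> s _.
    have [s0|s0] := leP s 0%R.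
      by rewrite (kerN _ s0) mule0 adde_ge0// !mule_ge0.
    have [s1|s1] := leP 1%R s.
      by rewrite [ker a _]kerN ?subr_le0// mul0e adde_ge0// !mule_ge0.
    rewrite !ker1E s0 subr_gt0 s1 mule1 mul1e.
    have [s2|s2] := leP s 2^-1%R.
      apply: (@le_trans _ _ (2%:E * ker b s)).
        by apply: lee_wpmul2r => //; apply: half; [rewrite a0 a1|lra].
      by rewrite leeDr// mule_ge0.
    apply: (@le_trans _ _ (2%:E * ker a (1 - s)%R)).
      by rewrite muleC; apply: lee_wpmul2r => //; apply: half; [rewrite b0 b1|exact: ltW].
    by rewrite leeDl// mule_ge0.
rewrite ge0_integralD//; last 4 first.
- by move=> s _; rewrite !mule_ge0.
- by apply: emeasurable_funM => //; exact: measurable_conv1.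
- by move=> s _; rewrite !mule_ge0.
- by apply: emeasurable_funM => //; exact: measurable_conv1.
rewrite !ge0_integralZl_EFin//; try exact: measurable_conv1;
  try by move=> s _; rewrite mule_ge0.
rewrite -!convE -!/(beta _ _) (betaC 1 b).
by apply: lte_add_pinfty; apply: lte_mul_pinfty => //; exact: beta1_lty.
Qed.

(** Both factors are at least 1 on []0, 1[], since their exponents are nonpositive. *)
Lemma beta_gt0 a b : (a <= 1)%R -> (b <= 1)%R -> 0 < beta a b.
Proof.
move=> a1 b1; apply: (@lt_le_trans _ _ 1); first by rewrite lte_fin.
have -> : 1 = \int[mu]_(s in `]0%R, 1%R[) (1 : \bar R).
  by rewrite integral_cst//= lebesgue_measure_itv/= lte_fin ltr01 sube0 mule1.
rewrite /beta convE integral_mkcond; apply: ge0_le_integral => //.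
- by move=> s _; rewrite patchE; case: ifP.
- apply/(measurable_restrictT (cst 1) _).1 => //.
- exact: measurable_conv1.
- move=> s _; rewrite patchE; case: ifPn; last by rewrite mule_ge0.
  rewrite inE/= in_itv/= => /andP[s0 s1].
  rewrite -(mule1 1); apply: lee_pmul => //.
  + have <- : ker a 1 = 1 by rewrite kerE// powR1.
    by apply: le_ker => //; lra.
  + have <- : ker b 1 = 1 by rewrite kerE// powR1.
    by apply: le_ker => //; lra.
Qed.

(** Finiteness is part of the claim, because [fine] maps +oo to 0. On []0, 1[] the integrand lies
    between [expR (-1)] and [x ^ (b - 1)]; from 1 on it is at most [expR (- x)], the density of the
    exponential law. *)
Lemma Gamma_gt0 b : (0 < b)%R -> (b <= 1)%R -> (0 < Gamma b)%R.
Proof.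
move=> b0 b1; rewrite /Gamma /Rintegral.
have mG : measurable_fun [set: R] (fun x => (x `^ (b - 1) * expR (- x))%:E).
  apply/measurable_EFinP; apply: measurable_funM; first exact: measurable_powR.
  by apply: measurableT_comp => //; exact: measurable_oppr.
apply: fine_gt0; apply/andP; split.
  apply: (@lt_le_trans _ _ (expR (-1))%:E); first by rewrite lte_fin expR_gt0.
  have -> : (expR (- 1))%:E = \int[mu]_(s in `]0%R, 1%R[) ((expR (-1))%:E : \bar R).
    by rewrite integral_cst//= lebesgue_measure_itv/= lte_fin ltr01 sube0 mule1.
  apply: (@le_trans _ _ (\int[mu]_(x in `]0%R, 1%R[) (x `^ (b - 1) * expR (- x))%:E)).
    apply: ge0_le_integral => //.
    - exact: measurable_funTS.
    - move=> x/=; rewrite in_itv/= => /andP[x0 x1]; rewrite lee_fin.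
      rewrite -[leLHS]mul1r; apply: ler_pM => //; rewrite ?expR_ge0//; last first.
        by rewrite ler_expR lerN2 ltW.
      have := @le_ker b x 1%R b1 x0 (ltW x1).
      by rewrite !kerE// powR1 lee_fin.
  apply: ge0_subset_integral => //.
  - exact: measurable_funTS.
  - by move=> x _; rewrite lee_fin mulr_ge0// ?powR_ge0 ?expR_ge0.
  - exact: subset_itvl.
rewrite integral_mkcond.
apply: (@le_lt_trans _ _ (\int[mu]_s ((ker 1 (1 - s)%R * ker b s) +
    (exponential_pdf 1 s)%:E))); last first.
  rewrite ge0_integralD//; last 4 first.
  - by move=> s _; rewrite mule_ge0.
  - exact: measurable_conv1.
  - by move=> s _; rewrite lee_fin exponential_pdf_ge0.
  - by apply/measurable_EFinP; exact: measurable_exponential_pdf.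
  rewrite integral_exponential_pdf// -convE -/(beta _ _) betaC.
  by apply: lte_add_pinfty; rewrite ?ltry// beta1_lty.
apply: ge0_le_integral => //.
- move=> s _; rewrite patchE; case: ifP => // _.
  by rewrite lee_fin mulr_ge0// ?powR_ge0 ?expR_ge0.
- by apply/(measurable_restrictT _ _).1 => //; exact: measurable_funTS.
- apply: emeasurable_funD; first exact: measurable_conv1.
  by apply/measurable_EFinP; exact: measurable_exponential_pdf.
- move=> s _; have E0 : 0 <= (exponential_pdf 1 s)%:E by rewrite lee_fin exponential_pdf_ge0.
  rewrite patchE; case: ifPn; last by rewrite adde_ge0// mule_ge0.
  rewrite inE/= in_itv/= andbT => s0.
  rewrite ker1E subr_gt0 kerE//; case: ifPn => s1.
    rewrite mul1e; apply: (@le_trans _ _ (s `^ (b - 1))%:E); last by rewrite leeDl.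
    rewrite lee_fin ler_piMr ?powR_ge0//.
    by rewrite expR_le1 oppr_le0 ltW.
  rewrite mul0e add0e lee_fin (@exponential_pdfE _ 1%R s (ltW s0)) mul1r mulN1r.
  rewrite ler_piMl ?expR_ge0//.
  have := @le_ker b 1%R s b1 ltr01; rewrite !kerE// powR1 lee_fin; apply.
  by rewrite leNgt.
Qed.

End kernel.

#[local] Hint Resolve ker_ge0 measurable_ker : core.

(** * Estimates on fractional integrals *)

Section estimates.
Context {R : realType}.
Local Open Scope ereal_scope.
Notation mu := (@lebesgue_measure R).
Implicit Types (f g : R -> \bar R) (a M s t x : R).

Lemma eq_conv_ker a f g t : (forall x, (x < t)%R -> f x = g x) ->
  conv (ker a) f t = conv (ker a) g t.
Proof.
by move=> fg; apply: eq_conv => x /ker_neq0; rewrite subr_gt0; exact: fg.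
Qed.

Lemma le_conv_ker a f g t : measurable_fun [set: R] f ->
  measurable_fun [set: R] g -> (forall x, 0 <= f x) -> (forall x, 0 <= g x) ->
  (forall x, (x < t)%R -> f x <= g x) -> conv (ker a) f t <= conv (ker a) g t.
Proof.
move=> mf mg f0 g0 fg; apply: (@le_conv_except _ _ _ _ _ 0%R) => // x _ /ker_gt0.
by rewrite subr_gt0; exact: fg.
Qed.

(** Once the factors are commuted, time enters only through the argument of [f]. *)
Lemma conv_ker_nd a f s t : measurable_fun [set: R] f -> (forall x, 0 <= f x) ->
  (forall x y, (x <= y)%R -> f x <= f y) -> (s <= t)%R ->
  conv (ker a) f s <= conv (ker a) f t.
Proof.
move=> mf f0 fnd st; rewrite convC// !convE; apply: ge0_le_integral => //.
- by move=> x _; rewrite mule_ge0.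
- exact: measurable_conv1.
- exact: measurable_conv1.
- by move=> x _; apply: lee_wpmul2r; [exact: ker_ge0|apply: fnd; rewrite lerD2r].
Qed.

Definition heaviside (c : R) x : \bar R := (if (c <= x)%R then 1 else 0)%:E.

Lemma measurable_heaviside c : measurable_fun [set: R] (heaviside c).
Proof.
apply/measurable_EFinP; apply: measurable_fun_ifT => //.
exact: measurable_fun_ler.
Qed.

Lemma heaviside_ge0 c x : 0 <= heaviside c x.
Proof. by rewrite lee_fin; case: ifP. Qed.

Hint Resolve measurable_heaviside heaviside_ge0 : core.

(* This is 1 / a; only positivity and finiteness are used. *)
Definition kmass a : R := fine (beta a 1).

Lemma kmass_ge0 a : (0 <= kmass a)%R.
Proof. by apply: fine_ge0; exact: beta_ge0. Qed.

Lemma kmass_gt0 a : (0 < a)%R -> (a <= 1)%R -> (0 < kmass a)%R.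
Proof. by move=> a0 a1; apply: fine_gt0; rewrite beta_gt0//= beta1_lty. Qed.

Lemma kmassE a : (0 < a)%R -> beta a 1 = (kmass a)%:E.
Proof. by move=> a0; rewrite fineK// ge0_fin_numE ?beta_ge0// beta1_lty. Qed.

(** Away from [c] the step is [ker 1] translated by [c], so this is [conv_kerE] with [b = 1]. *)
Lemma conv_ker_heaviside a c t : (0 < a)%R -> (c <= t)%R ->
  conv (ker a) (heaviside c) t = (kmass a * (t - c) `^ a)%:E.
Proof.
move=> a0 ct.
have mk : measurable_fun [set: R] (fun s => ker 1 (s - c)%R : \bar R).
  by apply: (measurableT_comp (measurable_ker 1)); exact: measurable_funB.
have -> : conv (ker a) (heaviside c) t = conv (ker a) (fun s => ker 1 (s - c)%R) t.
  by apply/eqP; rewrite eq_le; apply/andP; split;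
    apply: (@le_conv_except _ _ _ _ _ c) => // x xc _;
    rewrite ker1E /heaviside subr_gt0 lt_neqAle eq_sym xc.
rewrite conv_translate// conv_kerE kmassE// EFinM; congr (_ * _).
have [->|] := eqVneq t c.
  by rewrite subrr kerN// powR0// gt_eqF.
move=> tc; have ct' : (c < t)%R by rewrite lt_neqAle eq_sym tc.
by rewrite kerE ?subr_gt0// addrK.
Qed.

Lemma conv_ker_bound a M f c t : (0 < a)%R -> (0 <= M)%R -> (c <= t)%R ->
  measurable_fun [set: R] f -> (forall x, 0 <= f x) ->
  (forall x, (x < c)%R -> f x = 0) ->
  (forall x, (c <= x)%R -> (x < t)%R -> f x <= M%:E) ->
  conv (ker a) f t <= (M * (kmass a * (t - c) `^ a))%:E.
Proof.
move=> a0 M0 ct mf f0 fc fM.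
rewrite EFinM -conv_ker_heaviside// -convZr//; apply: le_conv_ker => //.
- exact: emeasurable_funM.
- by move=> x; rewrite mule_ge0.
- move=> x xt; rewrite /heaviside; case: ifPn => cx; first by rewrite mule1 fM.
  by rewrite mule0 fc// ltNge.
Qed.

(** The part of [f] before [t] contributes no more at [t'] than at [t], since the kernel is
    nonincreasing for [a <= 1]; the part after [t] is bounded by [M] and handled by
    [conv_ker_bound]. *)
Lemma conv_ker_modulus a M f t t' : (0 < a)%R -> (a <= 1)%R -> (0 <= M)%R ->
  (t <= t')%R ->
  measurable_fun [set: R] f -> (forall x, 0 <= f x) ->
  (forall x, (t <= x)%R -> (x < t')%R -> f x <= M%:E) ->
  conv (ker a) f t' <=
    conv (ker a) f t + (M * (kmass a * (t' - t) `^ a))%:E.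
Proof.
move=> a0 a1 M0 tt' mf f0 fM.
pose f1 x := if (x < t)%R then f x else 0.
pose f2 x := if (x < t)%R then 0 else f x.
have mt : measurable_fun [set: R] (fun x : R => (x < t)%R) by exact: measurable_fun_ltr.
have mf1 : measurable_fun [set: R] f1 by exact: measurable_fun_ifT.
have mf2 : measurable_fun [set: R] f2 by exact: measurable_fun_ifT.
have f10 x : 0 <= f1 x by rewrite /f1; case: ifP.
have f20 x : 0 <= f2 x by rewrite /f2; case: ifP.
have -> : conv (ker a) f t' = conv (ker a) (f1 \+ f2) t'.
  apply: eq_conv_ker => x _; rewrite /f1 /f2/=.
  by case: ifP; rewrite ?adde0 ?add0e.
rewrite convDr//; apply: leeD; last first.
  apply: conv_ker_bound => //.
  - by move=> x xt; rewrite /f2 xt.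
  - by move=> x tx xt'; rewrite /f2 ltNge tx/= fM.
rewrite !convE; apply: ge0_le_integral => //.
- by move=> s _; rewrite mule_ge0.
- exact: measurable_conv1.
- exact: measurable_conv1.
move=> s _; rewrite /f1; case: ifPn => st; last by rewrite mule0 mule_ge0.
by apply: lee_wpmul2r => //; apply: le_ker; rewrite ?subr_gt0// lerD2r.
Qed.

(** If [x] fell by more than [m], then [y] would have to rise by more than [m] to keep the sum from
    decreasing. *)
Lemma norm_le_of_sum (x x' y y' m w w' : R) : (x' <= x + m)%R ->
  (y' <= y + m)%R -> (x + y = w)%R -> (x' + y' = w')%R -> (w <= w')%R ->
  (`|x' - x| <= m)%R.
Proof. by move=> h1 h2 h3 h4 h5; rewrite ler_norml; apply/andP; split; lra. Qed.

(* Upward increments are bounded because the kernel is nonincreasing; downward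
   ones are upward increments for M - f, since f and M - f add up to a constant,
   whose fractional integral is nondecreasing. *)
Lemma conv_ker_holder a M (f : R -> R) t t' : (0 < a)%R -> (a <= 1)%R ->
  measurable_fun [set: R] f -> (forall x, 0 <= f x <= M)%R ->
  (forall x, (x < 0)%R -> f x = 0%R) -> (0 <= t)%R -> (t <= t')%R ->
  (`|fine (conv (ker a) (EFin \o f) t') - fine (conv (ker a) (EFin \o f) t)|
    <= M * (kmass a * (t' - t) `^ a))%R.
Proof.
move=> a0 a1 mf fM fN t0 tt'.
have t'0 := le_trans t0 tt'.
have M0 : (0 <= M)%R by have /andP[] := fM 0%R; exact: le_trans.
have mF : measurable_fun [set: R] (EFin \o f) by exact/measurable_EFinP.
have F0 x : 0 <= (EFin \o f) x by rewrite lee_fin; have /andP[] := fM x.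
pose g x := (if (0 <= x)%R then M - f x else 0)%R.
have mg : measurable_fun [set: R] (EFin \o g).
  apply/measurable_EFinP; apply: measurable_fun_ifT => //.
    exact: measurable_fun_ler.
  exact: measurable_funB.
have gM x : (0 <= g x <= M)%R.
  by have := fM x; rewrite /g; case: ifP => _; lra.
have gN x : (x < 0)%R -> g x = 0%R by rewrite /g leNgt => ->.
have G0 x : 0 <= (EFin \o g) x by rewrite lee_fin; have /andP[] := gM x.
have fin (h : R -> R) s : measurable_fun [set: R] (EFin \o h) ->
    (forall x, 0 <= h x <= M)%R ->
    (forall x, (x < 0)%R -> h x = 0%R) -> (0 <= s)%R ->
    conv (ker a) (EFin \o h) s = (fine (conv (ker a) (EFin \o h) s))%:E.
  move=> mh hM hN s0.
  have h0 x : 0 <= (EFin \o h) x by rewrite lee_fin; have /andP[] := hM x.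
  rewrite fineK// ge0_fin_numE ?conv_ge0//.
  apply: (@le_lt_trans _ _ (M * (kmass a * (s - 0) `^ a))%:E); last exact: ltry.
  apply: conv_ker_bound => // x; first by move=> /hN /= ->.
  by rewrite lee_fin; have /andP[] := hM x.
have mono (h : R -> R) : measurable_fun [set: R] (EFin \o h) ->
    (forall x, 0 <= h x <= M)%R ->
    (forall x, (x < 0)%R -> h x = 0%R) ->
    (fine (conv (ker a) (EFin \o h) t') <= fine (conv (ker a) (EFin \o h) t) +
     M * (kmass a * (t' - t) `^ a))%R.
  move=> mh hM hN.
  have h0 x : 0 <= (EFin \o h) x by rewrite lee_fin; have /andP[] := hM x.
  have hx x : (t <= x)%R -> (x < t')%R -> (EFin \o h) x <= M%:E.
    by move=> _ _; rewrite lee_fin; have /andP[] := hM x.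
  have := conv_ker_modulus a0 a1 M0 tt' mh h0 hx.
  by rewrite (fin h t' mh hM hN t'0) (fin h t mh hM hN t0).
have sum s : (0 <= s)%R -> (fine (conv (ker a) (EFin \o f) s) +
    fine (conv (ker a) (EFin \o g) s) = M * (kmass a * s `^ a))%R.
  move=> s0; apply: EFin_inj; rewrite EFinD -(fin f s mF fM fN s0).
  rewrite -(fin g s mg gM gN s0) -convDr//.
  rewrite EFinM -{2}[s]subr0 -conv_ker_heaviside// -convZr//.
  apply: eq_conv_ker => x _; rewrite /= /heaviside /g leNgt.
  have [x0|x0]/= := ltP x 0%R; first by rewrite fN// adde0 mule0.
  by rewrite mule1 -EFinD; congr EFin; ring.
have mf' := mono f mF fM fN.
have mg' := mono g mg gM gN.
have s1 := sum t t0; have s2 := sum t' t'0.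
have pw : (M * (kmass a * t `^ a) <= M * (kmass a * t' `^ a))%R.
  by rewrite ler_wpM2l// ler_wpM2l ?kmass_ge0// ge0_ler_powR// ?nnegrE ltW.
exact: (norm_le_of_sum mf' mg' s1 s2 pw).
Qed.

Lemma conv_ker_equicontinuous a M (f : R -> R) (e : R) : (0 < a)%R -> (a <= 1)%R ->
  measurable_fun [set: R] f -> (forall x, 0 <= f x <= M)%R ->
  (forall x, (x < 0)%R -> f x = 0%R) -> (0 < e)%R ->
  exists2 d : R, (0 < d)%R & forall t t', (0 <= t)%R -> (0 <= t')%R ->
    (`|t' - t| < d)%R ->
    (`|fine (conv (ker a) (EFin \o f) t') - fine (conv (ker a) (EFin \o f) t)| < e)%R.
Proof.
move=> a0 a1 mf fM fN e0.
have M0 : (0 <= M)%R by have /andP[] := fM 0%R; exact: le_trans.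
have K0 := kmass_ge0 a.
(* The [+ 1] keeps [K] positive even if [M = 0]; the radius [(e / K) ^ (1 / a)] below is the [d]
   with [K * d ^ a = e]. *)
set K := (M * kmass a + 1)%R.
have Kp : (0 < K)%R by rewrite /K ltr_pwDr// mulr_ge0.
exists ((e / K) `^ a^-1)%R; first by rewrite powR_gt0// divr_gt0.
have main t t' : (0 <= t)%R -> (t <= t')%R -> (t' - t < (e / K) `^ a^-1)%R ->
    (`|fine (conv (ker a) (EFin \o f) t') - fine (conv (ker a) (EFin \o f) t)| < e)%R.
  move=> t0 tt' d; apply: le_lt_trans (conv_ker_holder a0 a1 mf fM fN t0 tt') _.
  have : ((t' - t) `^ a < e / K)%R.
    have := gt0_ltr_powR a0 _ _ d; rewrite -powRrM mulVf ?gt_eqF// powRr1; last first.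
      by rewrite divr_ge0// ltW.
    by apply; rewrite nnegrE ?subr_ge0// powR_ge0.
  rewrite ltr_pdivlMr// => h; apply: le_lt_trans h.
  rewrite mulrA mulrC; apply: ler_wpM2l; first exact: powR_ge0.
  by rewrite /K lerDl.
move=> t t' t0 t'0; have [tt' d|/ltW t't d] := leP t t'.
  by apply: main => //; apply: le_lt_trans d; exact: ler_norm.
rewrite distrC; apply: main => //; apply: le_lt_trans d.
by rewrite distrC; exact: ler_norm.
Qed.

End estimates.

#[local] Hint Resolve measurable_heaviside heaviside_ge0 : core.

(** * Minimal solution of the Volterra equation *)

Section power.
Context {R : realType}.
Local Open Scope ereal_scope.

Lemma ge0_le_poweR (p : R) (x y : \bar R) : (0 <= p)%R -> 0 <= x -> x <= y ->
  x `^ p <= y `^ p.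
Proof.
move=> p0 x0 xy; apply: gt0_ler_poweR => //; rewrite in_itv/= leey andbT//.
exact: le_trans xy.
Qed.

(** An increasing bijection of [[0, +oo]] commutes with suprema; its inverse is the power
    [1 / p]. *)
Lemma ereal_sup_poweR (p : R) (u : (\bar R)^nat) : (0 < p)%R ->
  (forall n, 0 <= u n) ->
  ereal_sup (range (fun n => u n `^ p)) = ereal_sup (range u) `^ p.
Proof.
move=> p0 u0; have p0' := ltW p0.
have ule n : u n <= ereal_sup (range u) by apply: ereal_sup_ubound; exists n.
have s0 : 0 <= ereal_sup (range u) := le_trans (u0 0%N) (ule 0%N).
apply/eqP; rewrite eq_le; apply/andP; split.
  by apply: ge_ereal_sup => _ [n _ <-]; exact: ge0_le_poweR.
set S := ereal_sup (range (fun n => u n `^ p)).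
have uS n : u n `^ p <= S by apply: ereal_sup_ubound; exists n.
have S0 : 0 <= S := le_trans (poweR_ge0 _ _) (uS 0%N).
have -> : S = (S `^ p^-1) `^ p by rewrite -poweRrM mulVf ?gt_eqF// poweRe1.
apply: ge0_le_poweR => //; apply: ge_ereal_sup => _ [n _ <-].
have -> : u n = (u n `^ p) `^ p^-1 by rewrite -poweRrM mulfV ?gt_eqF// poweRe1.
by apply: ge0_le_poweR; rewrite ?invr_ge0// poweR_ge0.
Qed.

End power.

Section iteration.
Context {R : realType}.
Context (u0 p al c : R).
Context (u0_gt0 : 0 < u0) (p_gt1 : 1 < p) (al_gt0 : 0 < al) (al_le1 : al <= 1)
  (c_gt0 : 0 < c).
Local Open Scope ereal_scope.
Notation mu := (@lebesgue_measure R).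

Let p_gt0 : (0 < p)%R. Proof. exact: lt_trans p_gt1. Qed.
Let p_ge0 : (0 <= p)%R. Proof. exact: ltW. Qed.

Definition volterra (f : R -> \bar R) (t : R) : \bar R :=
  u0%:E + c%:E * conv (ker al) (fun s => f s `^ p) t.

Lemma volterraE f t :
  volterra f t = u0%:E + c%:E * conv (ker al) (fun s => f s `^ p) t.
Proof. by []. Qed.

(** Without the cutoff the iterates would be at least u0 at all negative times too, and the
    convolution would integrate them from -oo. The value 0 at [t = 0] is a convention that [sol]
    corrects. *)
Fixpoint picard (n : nat) (t : R) : \bar R :=
  if n is n'.+1 then if (0 < t)%R then volterra (picard n') t else 0 else 0.

Lemma picard0 t : picard 0 t = 0. Proof. by []. Qed.

Lemma picardS n t : (0 < t)%R -> picard n.+1 t = volterra (picard n) t.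
Proof. by rewrite /= => ->. Qed.

Lemma picard_le0 n t : (t <= 0)%R -> picard n t = 0.
Proof. by case: n => //= n; rewrite ltNge => ->. Qed.

Lemma measurable_power (f : R -> \bar R) : measurable_fun [set: R] f ->
  measurable_fun [set: R] (fun s => f s `^ p).
Proof. by move=> mf; exact: (measurableT_comp (measurable_poweR p)). Qed.

Lemma volterra_ge0 f t : 0 <= volterra f t.
Proof.
apply: adde_ge0; first by rewrite lee_fin ltW.
apply: mule_ge0; first by rewrite lee_fin ltW.
by apply: conv_ge0 => // x; exact: poweR_ge0.
Qed.

Lemma le_volterra f g t : measurable_fun [set: R] f ->
  measurable_fun [set: R] g -> (forall x, 0 <= f x) -> (forall x, 0 <= g x) ->
  (forall x, (x < t)%R -> f x <= g x) -> volterra f t <= volterra g t.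
Proof.
move=> mf mg f0 g0 fg; rewrite /volterra leeD2l//.
apply: lee_wpmul2l; first by rewrite lee_fin ltW.
apply: le_conv_ker => //; try exact: measurable_power; try by move=> x; exact: poweR_ge0.
by move=> x xt; apply: ge0_le_poweR => //; exact: fg.
Qed.

Lemma measurable_volterra f : measurable_fun [set: R] f ->
  measurable_fun [set: R] (volterra f).
Proof.
move=> mf; apply: emeasurable_funD => //; apply: emeasurable_funM => //.
apply: measurable_conv => //; first exact: measurable_power.
by move=> x; exact: poweR_ge0.
Qed.

Lemma picard_ge0 n t : 0 <= picard n t.
Proof. by case: n => //= n; case: ifP => // _; exact: volterra_ge0. Qed.

Lemma measurable_picard n : measurable_fun [set: R] (picard n).
Proof.
elim: n => [|n IH] /=; first exact: measurable_cst.
apply: measurable_fun_ifT => //; first exact: measurable_fun_ltr.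
exact: measurable_volterra.
Qed.

Lemma picard_incr n t : picard n t <= picard n.+1 t.
Proof.
elim: n t => [|n IH] t; first by rewrite picard0 picard_ge0.
have [t0|t0] := leP t 0%R; first by rewrite !picard_le0.
rewrite (picardS n t0) (picardS n.+1 t0); apply: le_volterra.
- exact: measurable_picard.
- exact: measurable_picard.
- by move=> x; exact: picard_ge0.
- by move=> x; exact: picard_ge0.
- by move=> x _; exact: IH.
Qed.

Lemma picard_nd t : nondecreasing_seq (picard^~ t).
Proof. by apply/nondecreasing_seqP => n; exact: picard_incr. Qed.

Lemma picard_mono n s t : (s <= t)%R -> picard n s <= picard n t.
Proof.
elim: n s t => [|n IH] s t st; first by rewrite !picard0.
have [s0|s0] := ltP 0%R s; last by rewrite picard_le0// picard_ge0.
rewrite !picardS//; last exact: lt_le_trans st.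
rewrite !volterraE leeD2l//; apply: lee_wpmul2l; first by rewrite lee_fin ltW.
apply: conv_ker_nd => //.
- by apply: measurable_power; exact: measurable_picard.
- by move=> x; exact: poweR_ge0.
- by move=> x y xy; apply: ge0_le_poweR => //; [exact: picard_ge0|exact: IH].
Qed.

Definition minsol (t : R) : \bar R := ereal_sup (range (picard^~ t)).

Lemma picard_le_minsol n t : picard n t <= minsol t.
Proof. by apply: ereal_sup_ubound; exists n. Qed.

Lemma minsol_ge0 t : 0 <= minsol t.
Proof. exact: (le_trans (picard_ge0 0 t) (picard_le_minsol 0 t)). Qed.

Lemma picard_cvg t : picard^~ t @ \oo --> minsol t.
Proof. exact: (ereal_nondecreasing_cvgn (picard_nd t)). Qed.

Lemma measurable_minsol : measurable_fun [set: R] minsol.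
Proof.
apply: (@emeasurable_fun_cvg _ _ _ _ picard) => [n|t _].
  exact: measurable_picard.
exact: picard_cvg.
Qed.

Lemma minsol_le t (x : \bar R) : (forall n, picard n t <= x) -> minsol t <= x.
Proof. by move=> h; apply: ge_ereal_sup => _ [n _ <-]; exact: h. Qed.

Lemma minsol_poweR t :
  (fun n => picard n t `^ p) @ \oo --> minsol t `^ p.
Proof.
rewrite /minsol -ereal_sup_poweR//; last by move=> n; exact: picard_ge0.
apply: ereal_nondecreasing_cvgn => m n mn; apply: ge0_le_poweR => //.
  exact: picard_ge0.
exact: (picard_nd t).
Qed.

Lemma minsol_mono s t : (s <= t)%R -> minsol s <= minsol t.
Proof.
move=> st; apply: minsol_le => n.
exact: (le_trans (picard_mono n st) (picard_le_minsol n t)).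
Qed.

Lemma minsol_le0 t : (t <= 0)%R -> minsol t = 0.
Proof.
move=> t0; apply/eqP; rewrite eq_le minsol_ge0 andbT.
by apply: minsol_le => n; rewrite picard_le0.
Qed.

(** Both sides are limits of [picard n.+1 t], the right one by monotone convergence. *)
Lemma minsolE t : (0 < t)%R -> minsol t = volterra minsol t.
Proof.
move=> t0.
have cint : conv (ker al) (fun s => picard n s `^ p) t @[n --> \oo] -->
    conv (ker al) (fun s => minsol s `^ p) t.
  rewrite [X in X @ _ --> _](_ : _ = fun n =>
      \int[mu]_s (ker al (t - s)%R * picard n s `^ p)); last first.
    by apply/funext => n; rewrite convE.
  rewrite convE.
  have -> : \int[mu]_s (ker al (t - s)%R * minsol s `^ p) =
     \int[mu]_s limn (fun n => ker al (t - s)%R * picard n s `^ p).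
    apply: eq_integral => s _; apply/esym/cvg_lim => //.
    by apply: cvgeZl => //; exact: minsol_poweR.
  apply: cvg_monotone_convergence => //.
  - move=> n; apply: measurable_conv1 => //.
    by apply: measurable_power; exact: measurable_picard.
  - by move=> n s _; rewrite mule_ge0// poweR_ge0.
  - move=> s _ m n mn; apply: lee_wpmul2l; first exact: ker_ge0.
    apply: ge0_le_poweR => //; first exact: picard_ge0.
    exact: (picard_nd s).
have cv : picard n.+1 t @[n --> \oo] --> volterra minsol t.
  under eq_fun do rewrite (picardS _ t0) volterraE.
  rewrite volterraE; apply: cvgeD => //.
  - exact: cvg_cst.
  - exact: cvgeZl.
have cm : picard n.+1 t @[n --> \oo] --> minsol t.
  by rewrite (@cvg_shiftS _ (picard^~ t)); exact: picard_cvg.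
have <- := cvg_lim (@ereal_hausdorff R) cm.
exact: (cvg_lim (@ereal_hausdorff R) cv).
Qed.

(** Every iterate stays below [v], as [volterra] is monotone; it looks only at the past, so the
    comparison is valid up to any horizon [T]. *)
Lemma minsol_le_super v T : measurable_fun [set: R] v -> (forall x, 0 <= v x) ->
  (forall t, (0 < t)%R -> (t < T)%R -> volterra v t <= v t) ->
  forall t, (t < T)%R -> minsol t <= v t.
Proof.
move=> mv v0 hv t tT; apply: minsol_le => n.
elim: n t tT => [|n IH] t tT; first by rewrite picard0.
have [t0|t0] := leP t 0%R; first by rewrite picard_le0.
rewrite picardS//; apply: le_trans (hv t t0 tT).
apply: le_volterra => //; [exact: measurable_picard|exact: picard_ge0|].
by move=> x xt; apply: IH; exact: lt_trans tT.
Qed.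

Lemma minsol_ge_u0 t : (0 < t)%R -> u0%:E <= minsol t.
Proof.
move=> t0; rewrite minsolE// volterraE leeDl//.
apply: mule_ge0; first by rewrite lee_fin ltW.
by apply: conv_ge0 => // x; exact: poweR_ge0.
Qed.

(** The bound is assumed strictly before [t], so that [t] may be the blow-up time itself. The
    supersolution [v] follows [minsol] before [t] and is the constant [K] from [t] on. *)
Lemma minsol_extend (t A : R) : (0 <= t)%R ->
  (forall s, (s < t)%R -> minsol s <= A%:E) ->
  exists2 t' : R, (t < t')%R & minsol t' < +oo.
Proof.
move=> t0 hA.
wlog A0 : A hA / (0 <= A)%R.
  move=> W; apply: (W (Num.max A 0%R)); last by rewrite le_max lexx orbT.
  by move=> s /hA hs; apply: le_trans hs _; rewrite lee_fin le_max lexx.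
pose f s : \bar R := if (s < t)%R then minsol s else 0.
have mf : measurable_fun [set: R] f.
  apply: measurable_fun_ifT => //; first exact: measurable_fun_ltr.
  exact: measurable_minsol.
pose B : R := (A `^ p * (kmass al * (t - 0) `^ al))%R.
have hB : conv (ker al) (fun s => minsol s `^ p) t <= B%:E.
  apply: conv_ker_bound => //.
  - exact: powR_ge0.
  - by apply: measurable_power; exact: measurable_minsol.
  - by move=> x; exact: poweR_ge0.
  - by move=> x x0; rewrite minsol_le0 ?ltW// poweR0r// gt_eqF.
  - move=> x _ xt; rewrite -poweR_EFin; apply: ge0_le_poweR => //.
      exact: minsol_ge0.
    exact: hA.
have B0 : (0 <= B)%R.
  by rewrite /B mulr_ge0 ?powR_ge0// mulr_ge0 ?powR_ge0 ?kmass_ge0.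
(* By time [t] the history accounts for at most [u0 + c * B]. The margin 1 is reserved for what [v]
   itself adds after [t], at most [D * (s - t) ^ al]; the delay [d] below solves
   [D * d ^ al = 1]. *)
pose K : R := (u0 + c * B + 1)%R.
have K0 : (0 < K)%R by rewrite /K addr_gt0// ltr_pwDl// mulr_ge0// ltW.
pose D := (c * (K `^ p * kmass al))%R.
have D0 : (0 < D)%R by rewrite /D !mulr_gt0// ?powR_gt0// kmass_gt0.
pose d := (D^-1 `^ al^-1)%R.
have d0 : (0 < d)%R by rewrite powR_gt0// invr_gt0.
pose v s : \bar R := if (s < t)%R then minsol s else K%:E.
have mv : measurable_fun [set: R] v.
  apply: measurable_fun_ifT => //; first exact: measurable_fun_ltr.
  exact: measurable_minsol.
have v0 x : 0 <= v x.
  by rewrite /v; case: ifP => _; [exact: minsol_ge0|rewrite lee_fin ltW].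
have mvp := measurable_power mv.
have vp0 x : 0 <= v x `^ p by exact: poweR_ge0.
have Econv s : (s <= t)%R -> conv (ker al) (fun s => v s `^ p) s =
    conv (ker al) (fun s => minsol s `^ p) s.
  move=> st; apply: eq_conv_ker => x xs.
  by rewrite /v (lt_le_trans xs st).
have super s : (0 < s)%R -> (s < t + d)%R -> volterra v s <= v s.
  move=> s0 std; rewrite {2}/v; case: ifPn => [st|].
    by rewrite minsolE// !volterraE Econv// ltW.
  rewrite -leNgt => ts.
  have h : conv (ker al) (fun s => v s `^ p) s <=
      (B + K `^ p * (kmass al * (s - t) `^ al))%:E.
    apply: (@le_trans _ _ (conv (ker al) (fun s => v s `^ p) t +
        (K `^ p * (kmass al * (s - t) `^ al))%:E)).
      apply: conv_ker_modulus => //; first exact: powR_ge0.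
      by move=> x tx xs; rewrite /v ltNge tx.
    by rewrite EFinD leeD2r// Econv.
  rewrite volterraE; apply: (@le_trans _ _ (u0%:E + c%:E *
      (B + K `^ p * (kmass al * (s - t) `^ al))%:E)).
    by rewrite leeD2l//; apply: lee_wpmul2l => //; rewrite lee_fin ltW.
  rewrite -EFinM -EFinD lee_fin /K mulrDr addrA lerD2l.
  rewrite [X in (X <= _)%R](_ : _ = (D * (s - t) `^ al)%R); last by rewrite /D; ring.
  have -> : 1%R = (D * d `^ al)%R.
    rewrite /d -powRrM mulVf ?gt_eqF// powRr1 ?invr_ge0 ?ltW//.
    by rewrite mulfV// gt_eqF.
  rewrite ler_wpM2l//; first exact: ltW.
  rewrite ge0_ler_powR ?nnegrE ?subr_ge0//; [exact: ltW|exact: ltW|].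
  by rewrite lerBlDl ltW.
exists (t + d / 2)%R; first by rewrite ltrDl divr_gt0.
apply: le_lt_trans (minsol_le_super mv v0 super _) _.
  by rewrite ltrD2l ltr_pdivrMr// ltr_pMr// ltr1n.
by rewrite /v ifF ?ltry//; apply/negbTE; rewrite -leNgt lerDl divr_ge0// ltW.
Qed.

(** By monotonicity the solution stays above [m] after [t], so its power dominates [m ^ p] times the
    step at [t]; u0 and the earlier history are dropped. *)
Lemma minsol_growth (t h m : R) : (0 < t)%R -> (0 <= h)%R -> (0 <= m)%R ->
  m%:E <= minsol t -> (c * (m `^ p * (kmass al * h `^ al)))%:E <= minsol (t + h)%R.
Proof.
move=> t0 h0 m0 mt; rewrite (@minsolE (t + h)%R); last by rewrite ltr_pwDl.
rewrite volterraE; apply: le_trans (leeDr _ _); last by rewrite lee_fin ltW.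
rewrite EFinM; apply: lee_wpmul2l; first by rewrite lee_fin ltW.
have -> : h = (t + h - t)%R by ring.
rewrite EFinM -conv_ker_heaviside//; last by rewrite lerDl.
rewrite -convZr ?powR_ge0//.
have -> : (t + (t + h - t) = t + h)%R by ring.
apply: le_conv_ker => //.
- by apply: emeasurable_funM; [exact: measurable_cst|exact: measurable_heaviside].
- by apply: measurable_power; exact: measurable_minsol.
- by move=> x; rewrite mule_ge0// lee_fin powR_ge0.
- by move=> x; exact: poweR_ge0.
- move=> x _; rewrite /heaviside; case: ifPn => tx; last by rewrite mule0 poweR_ge0.
  rewrite mule1 -poweR_EFin; apply: ge0_le_poweR => //.
  exact: le_trans mt (minsol_mono tx).
Qed.

Lemma minsol_blowup : exists T : R, minsol T = +oo.
Proof.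
(* [C] and [q] make the bound of [minsol_growth] equal to [2 * m] for the level [m = u0 * 2 ^ k] and
   the wait [h = C * q ^ k]. The case [k = 0] determines [C]; passing from [k] to [k + 1] requires
   [2 ^ p * q ^ al = 2], which gives [q], and [q < 1] because [p > 1]. *)
pose C : R := ((2 * u0 / (c * (kmass al * u0 `^ p))) `^ al^-1)%R.
pose q : R := (2 `^ (- ((p - 1) / al)))%R.
have k0 : (0 < kmass al)%R by exact: kmass_gt0.
have up0 : (0 < u0 `^ p)%R by rewrite powR_gt0.
have C0 : (0 < C)%R by rewrite powR_gt0// !(divr_gt0, mulr_gt0).
have q0 : (0 < q)%R by rewrite powR_gt0.
have q1 : (q < 1)%R.
  rewrite /q powRN invf_lt1 ?powR_gt0//.
  have := @gt0_ltr_powR R ((p - 1) / al); rewrite divr_gt0 ?subr_gt0// => /(_ isT 1 2)%R.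
  by rewrite powR1; apply; rewrite ?nnegrE// ltr1n.
(* Time 1 plus the first [k] waits. A positive starting time is required, since [minsol] is 0 at
   time 0. *)
pose t k : R := (1 + C * (1 - q ^+ k) / (1 - q))%R.
have q1' : (1 - q != 0)%R by rewrite subr_eq0 eq_sym lt_eqF.
have tS k : (t k.+1 = t k + C * q ^+ k)%R.
  by rewrite /t exprS; field.
have t0 k : (0 < t k)%R.
  rewrite ltr_pwDl// divr_ge0//; last by rewrite subr_ge0 ltW.
  by rewrite mulr_ge0 ?(ltW C0)// subr_ge0 exprn_ile1 ?ltW.
have claim k : (u0 * 2 ^+ k)%:E <= minsol (t k).
  elim: k => [|k IH]; first by rewrite expr0 mulr1 minsol_ge_u0.
  rewrite tS.
  have h0 : (0 <= C * q ^+ k)%R by rewrite mulr_ge0 ?exprn_ge0 ?ltW.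
  have m0 : (0 <= u0 * 2 ^+ k)%R by rewrite mulr_ge0 ?exprn_ge0 ?ltW.
  apply: le_trans (minsol_growth (t0 k) h0 m0 IH).
  rewrite lee_fin le_eqVlt; apply/orP; left; apply/eqP.
  rewrite !powRM ?exprn_ge0 ?ltW//.
  have Ca : (C `^ al = 2 * u0 / (c * (kmass al * u0 `^ p)))%R.
    by rewrite /C -powRrM mulVf ?gt_eqF// powRr1// !(divr_ge0, mulr_ge0)// ltW.
  have qa : ((2 ^+ k) `^ p * (q ^+ k) `^ al = 2 ^+ k)%R.
    rewrite -!powR_mulrn ?ltW// /q -!powRrM -powRD ?pnatr_eq0 ?implybT//.
    by congr powR; field; rewrite gt_eqF.
  rewrite Ca exprS.
  transitivity (2 * u0 * ((2 ^+ k) `^ p * (q ^+ k) `^ al))%R; first by rewrite qa; ring.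
  by field; rewrite !gt_eqF.
exists (1 + C / (1 - q))%R.
have tT k : (t k <= 1 + C / (1 - q))%R.
  rewrite /t lerD2l ler_pM2r ?invr_gt0 ?subr_gt0//.
  by rewrite -[leRHS]mulr1 ler_pM2l// gerBl exprn_ge0// ltW.
apply: eq_infty => A.
have [k Ak] : exists k : nat, (A / u0 <= 2 ^+ k)%R.
  exists (Num.truncn (A / u0)).+1.
  apply: (@le_trans _ _ ((Num.truncn (A / u0)).+1%:R)%R).
    exact/ltW/truncnS_gt.
  by rewrite -natrX ler_nat ltnW// ltn_expl.
apply: le_trans (le_trans (claim k) (minsol_mono (tT k))).
by rewrite lee_fin mulrC -ler_pdivrMr.
Qed.

Definition blowup_time : R := sup [set t : R | (0 <= t)%R /\ minsol t < +oo].

Lemma blowup_time_has_sup : has_sup [set t : R | (0 <= t)%R /\ minsol t < +oo].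
Proof.
split; first by exists 0%R; rewrite /= minsol_le0.
have [T hT] := minsol_blowup; exists T => t [_ ht].
rewrite leNgt; apply/negP => Tt.
by move: ht; rewrite ltNge => /negP; apply; rewrite -hT; exact/minsol_mono/ltW.
Qed.

Lemma lt_blowup_time t : minsol t < +oo -> (t <= blowup_time)%R.
Proof.
move=> h; have [t0|t0] := leP 0%R t.
  by apply: ub_le_sup; [have [] := blowup_time_has_sup|].
apply: le_trans (ltW t0) _.
by apply: ub_le_sup; [have [] := blowup_time_has_sup|rewrite /= minsol_le0].
Qed.

Lemma blowup_time_lt t : (t < blowup_time)%R -> minsol t < +oo.
Proof.
move=> h; have := sup_adherent _ blowup_time_has_sup; rewrite -/blowup_time.
move=> /(_ (blowup_time - t)%R); rewrite subr_gt0 => /(_ h)[s [_ hs]].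
rewrite subKr => ts; exact: le_lt_trans (minsol_mono (ltW ts)) hs.
Qed.

(** Prolongation from time 0, before which [minsol] is bounded by 0. *)
Lemma blowup_time_gt0 : (0 < blowup_time)%R.
Proof.
have [s s0|t t0 /lt_blowup_time] := @minsol_extend 0%R 0%R (lexx _).
  by rewrite minsol_le0// ltW.
exact: lt_le_trans.
Qed.

Lemma minsol_unbounded A : exists t : R,
  [/\ (0 < t)%R, (t < blowup_time)%R & A%:E < minsol t].
Proof.
apply: contrapT => H.
have bnd s : (s < blowup_time)%R -> minsol s <= (Num.max A 0%R)%:E.
  move=> sT; have [s0|s0] := leP s 0%R.
    by rewrite minsol_le0// lee_fin le_max lexx orbT.
  apply: (@le_trans _ _ A%:E); last by rewrite lee_fin le_max lexx.
  by rewrite leNgt; apply/negP => As; apply: H; exists s.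
have [t' tt' /lt_blowup_time] := minsol_extend (ltW blowup_time_gt0) bnd.
by rewrite leNgt tt'.
Qed.

End iteration.

(** * Caputo derivatives and the Volterra equation *)

Section caputo_conv.
Context {R : realType}.
Notation mu := (@lebesgue_measure R).

(* Exact also at s = t, where 0 `^ (- al) = 0 is also the value of the kernel. *)
Lemma conv_ker_itv (al t : R) (F : R -> R) : al != 0 ->
  (\int[mu]_(s in `[0%R, t]) ((t - s) `^ (- al) * F s)%:E)%E =
  conv (ker (1 - al)) (fun s => (if 0 <= s then F s else 0)%:E) t.
Proof.
have E : 1 - al - 1 = - al by ring.
move=> a1; rewrite convE integral_mkcond; apply: eq_integral => s _.
rewrite patchE mem_setE in_itv/=; have [s0|s0]/= := leP 0 s; last by rewrite mule0.
rewrite /ker E subr_gt0 le_eqVlt; have [->|st]/= := eqVneq s t.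
  by rewrite subrr powR0 ?oppr_eq0// mul0r ltxx mul0e.
by case: ifP; rewrite ?mul0e.
Qed.

Lemma conv_ker1_itv (t : R) (F : R -> \bar R) : measurable_fun [set: R] F ->
  (forall s, s < 0 -> F s = 0%E) ->
  conv (ker 1) F t = (\int[mu]_(s in `[0%R, t]) F s)%E.
Proof.
move=> mF F0; rewrite -integral_itv_bndo_bndc; last exact: measurable_funTS.
rewrite convE [RHS]integral_mkcond; apply: eq_integral => s _.
rewrite patchE mem_setE in_itv/= ker1E subr_gt0.
have [s0|s0]/= := leP 0 s; last by rewrite F0// mule0.
by case: ifP; rewrite ?mul1e ?mul0e.
Qed.

Section bounded.
Context (M : R) (f : R -> R).
Hypotheses (mf : measurable_fun [set: R] f) (fM : forall x, 0 <= f x <= M)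
  (f0 : forall x, x < 0 -> f x = 0).

Let mF : measurable_fun [set: R] (EFin \o f). Proof. exact/measurable_EFinP. Qed.
Let F0 x : (0 <= (EFin \o f) x)%E.
Proof. by rewrite lee_fin; have /andP[] := fM x. Qed.
Let M0 : 0 <= M. Proof. by have /andP[] := fM 0; exact: le_trans. Qed.

Lemma conv_ker_le0 a t : t <= 0 -> conv (ker a) (EFin \o f) t = 0%E.
Proof.
move=> t0; rewrite (@eq_conv_ker _ a _ (cst 0%E)).
  by rewrite convE integral0_eq// => s _; rewrite mule0.
by move=> x xt /=; rewrite f0// (lt_le_trans xt).
Qed.

Lemma conv_ker_fin a t : 0 < a ->
  conv (ker a) (EFin \o f) t = (fine (conv (ker a) (EFin \o f) t))%:E.
Proof.
move=> a0; have [t0|t0] := leP t 0; first by rewrite conv_ker_le0.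
rewrite fineK// ge0_fin_numE; last by apply: conv_ge0 => // x; exact: F0.
apply: (@le_lt_trans _ _ (M * (kmass a * (t - 0) `^ a))%:E); last exact: ltry.
apply: conv_ker_bound => //; first exact: ltW.
- by move=> x /f0 /= ->.
- by move=> x _ _; rewrite lee_fin; have /andP[] := fM x.
Qed.

Lemma is_derive_conv_ker1 t : 0 < t -> {for t, continuous f} ->
  is_derive t 1 (fun t => fine (conv (ker 1) (EFin \o f) t)) (f t).
Proof.
move=> t0 cf.
have fi : mu.-integrable `[0, t + 1] (EFin \o f).
  apply/integrableP; split; first exact: measurable_funTS.
  under eq_integral do rewrite gee0_abs//.
  rewrite -conv_ker1_itv//; last by move=> s /f0 /= ->.
  by rewrite conv_ker_fin ?ltry.
have t1 : t < t + 1 by rewrite ltrDl.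
have [dF eF] := @continuous_FTC1_closed R f 0 t (t + 1) t1 fi t0 cf.
have -> : (fun t => fine (conv (ker 1) (EFin \o f) t)) =
    (fun x => \int[mu]_(t in `[0, x]) f t).
  by apply/funext => x; rewrite conv_ker1_itv// => s /f0 /= ->.
by apply: DeriveDef; [exact: dF|rewrite -derive1E; exact: eF].
Qed.

End bounded.

Lemma Gamma_inv_gt0 (al : R) : 0 < al -> al < 1 -> 0 < Gamma (1 - al).
Proof. by move=> a0 a1; apply: Gamma_gt0; lra. Qed.

Definition kbeta (al : R) : R := fine (beta (1 - al) al).

Lemma kbetaE al : 0 < al -> al < 1 -> beta (1 - al) al = (kbeta al)%:E.
Proof.
move=> a0 a1; rewrite fineK// ge0_fin_numE ?beta_ge0//.
by apply: beta_lty; lra.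
Qed.

Lemma kbeta_gt0 al : 0 < al -> al < 1 -> 0 < kbeta al.
Proof.
move=> a0 a1; rewrite -lte_fin -kbetaE//.
by apply: beta_gt0; lra.
Qed.

(* The Beta-Gamma identity makes this (Gamma al)^-1. *)
Definition rl_coef (al : R) : R := Gamma (1 - al) / kbeta al.

Lemma rl_coef_gt0 al : 0 < al -> al < 1 -> 0 < rl_coef al.
Proof. by move=> a0 a1; rewrite divr_gt0 ?kbeta_gt0 ?Gamma_inv_gt0. Qed.

(** Abel's device: the orders [1 - al] and [al] add up to 1, so two fractional integrations amount
    to an ordinary one. *)
Lemma conv_ker_ker (al t : R) (F : R -> \bar R) : 0 < al -> al < 1 ->
  measurable_fun [set: R] F -> (forall x, 0 <= F x)%E ->
  conv (ker (1 - al)) (conv (ker al) F) t = ((kbeta al)%:E * conv (ker 1) F t)%E.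
Proof.
move=> a0 a1 mF F0; rewrite convA//.
have -> : conv (ker (1 - al)) (ker al) = (fun x => (kbeta al)%:E * ker 1 x)%E.
  by apply/funext => x; rewrite conv_kerE kbetaE// subrK.
have b0 := ltW (kbeta_gt0 a0 a1).
rewrite convC//; last 2 first.
- by apply: emeasurable_funM => //; exact: measurable_ker.
- by move=> x; rewrite mule_ge0.
by rewrite convZr// convC.
Qed.

(** * From the Volterra equation to the Caputo equation *)

Section volterra_caputo.
Context (al u0 M T : R) (f u : R -> R).
Hypotheses (al0 : 0 < al) (al1 : al < 1).
Hypotheses (mf : measurable_fun [set: R] f) (fM : forall x, 0 <= f x <= M)
  (f0 : forall x, x < 0 -> f x = 0).
Hypothesis uE : forall t, 0 <= t -> t <= T ->
  u t = u0 + rl_coef al * fine (conv (ker al) (EFin \o f) t).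

Lemma volterra_init : 0 <= T -> u 0 = u0.
Proof. by move=> T0; rewrite uE// (conv_ker_le0 f0)// mulr0 addr0. Qed.

Lemma volterra_equicontinuous (e : R) : 0 < e ->
  exists2 d : R, 0 < d & forall t t', 0 <= t -> t <= T -> 0 <= t' -> t' <= T ->
    `|t' - t| < d -> `|u t' - u t| < e.
Proof.
move=> e0; have c0 := rl_coef_gt0 al0 al1.
have ec0 : 0 < e / rl_coef al by rewrite divr_gt0.
have [d d0 H] := conv_ker_equicontinuous al0 (ltW al1) mf fM f0 ec0.
exists d => // t t' t0 tT t'0 t'T /(H _ _ t0 t'0).
rewrite !uE// opprD addrACA subrr add0r -mulrBr normrM (gtr0_norm c0).
by rewrite ltr_pdivlMr// mulrC.
Qed.

(** [u - u 0] is [rl_coef al] times a fractional integral of [f]; applying [conv_ker_ker], the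
    constants cancel because [rl_coef al * kbeta al = Gamma (1 - al)]. *)
Lemma volterra_caputo_primitive t : 0 <= t -> t <= T ->
  caputo_primitive al u t = fine (conv (ker 1) (EFin \o f) t).
Proof.
move=> t0 tT; have T0 := le_trans t0 tT.
have c0 := rl_coef_gt0 al0 al1.
have mF : measurable_fun [set: R] (EFin \o f) by exact/measurable_EFinP.
have F0 x : (0 <= (EFin \o f) x)%E by rewrite lee_fin; have /andP[] := fM x.
rewrite /caputo_primitive /Rintegral.
rewrite conv_ker_itv ?gt_eqF//.
rewrite (@eq_conv_ker _ _ _ (fun s => (rl_coef al)%:E * conv (ker al) (EFin \o f) s)%E).
  rewrite convZr//; last 3 first.
  - exact: measurable_conv.
  - by move=> x; exact: conv_ge0.
  - exact: ltW.
  rewrite conv_ker_ker// (conv_ker_fin mf fM f0 t ltr01) -!EFinM/=.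
  rewrite /rl_coef; field; rewrite !gt_eqF ?kbeta_gt0 ?Gamma_inv_gt0//.
move=> s st; case: ifPn => [s0|].
  rewrite volterra_init// uE ?(le_trans (ltW st))// addrC addKr EFinM.
  by rewrite -(conv_ker_fin mf fM f0).
by rewrite -ltNge => s0; rewrite (conv_ker_le0 f0) ?mule0// ltW.
Qed.

Lemma volterra_caputo t : 0 < t -> t < T -> {for t, continuous f} ->
  derivable (caputo_primitive al u) t 1 /\ caputo al u t = f t.
Proof.
move=> t0 tT cf.
have := is_derive_conv_ker1 mf fM f0 t0 cf.
move=> /(@near_eq_is_derive R R^o R^o _ (caputo_primitive al u) t 1 (f t)) H.
have [|dp <-] := H; last first.
  by split; [exact: dp|rewrite /caputo derive1E].
near=> x; rewrite volterra_caputo_primitive//.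
- by apply/ltW; near: x; exact: lt_nbhsr.
- by apply/ltW; near: x; exact: lt_nbhsl.
Unshelve. all: by end_near. Qed.

End volterra_caputo.

(** Time is cut into windows of a fixed length [d]. If [w] vanishes up to [n * d], the inequality
    halves any bound for [w] on the next window; repeated [k] times it gives [M / 2 ^ k], so [w]
    vanishes there too. *)
Lemma conv_gronwall (al K M : R) (w : R -> R) : 0 < al -> 0 <= K ->
  measurable_fun [set: R] w -> (forall x, 0 <= w x <= M) ->
  (forall x, x <= 0 -> w x = 0) ->
  (forall t, (w t)%:E <= K%:E * conv (ker al) (EFin \o w) t)%E ->
  forall t, w t = 0.
Proof.
move=> a0 K0 mw wM w0 hw.
have M0 : 0 <= M by have /andP[] := wM 0; exact: le_trans.
have mW : measurable_fun [set: R] (EFin \o w) by exact/measurable_EFinP.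
have W0 x : (0 <= (EFin \o w) x)%E by rewrite lee_fin; have /andP[] := wM x.
have k0 : 0 <= kmass al := kmass_ge0 al.
(* With [d ^ al = D], the factor [K * kmass al * d ^ al] of one application is at most 1/2; the
   [+ 1] avoids division by 0. *)
pose D := (2 * (K * kmass al + 1))^-1.
have D0 : 0 < D by rewrite invr_gt0 mulr_gt0// ltr_pwDr// mulr_ge0.
pose d := D `^ al^-1.
have d0 : 0 < d by rewrite powR_gt0.
have KD : K * (kmass al * d `^ al) <= 2^-1.
  rewrite /d -powRrM mulVf ?gt_eqF// (powRr1 (ltW D0)) /D mulrA.
  rewrite ler_pdivrMr ?mulr_gt0 ?ltr_pwDr ?mulr_ge0//.
  have := mulr_ge0 K0 k0; move: (K * kmass al) => x x0; lra.
have vanish n s : s <= n%:R * d -> w s = 0.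
  elim: n s => [|n IH] s; first by rewrite mul0r; exact: w0.
  rewrite -natr1 mulrDl mul1r => snd.
  have half k : forall r, r <= n%:R * d + d -> w r <= M / 2 ^+ k.
    elim: k => [|k IHk] r rnd.
      by rewrite expr0 divr1; have /andP[] := wM r.
    have [rn|/ltW rn] := leP r (n%:R * d).
      by rewrite IH// divr_ge0// exprn_ge0.
    have Mk0 : 0 <= M / 2 ^+ k by rewrite divr_ge0// exprn_ge0.
    have B : (conv (ker al) (EFin \o w) r <=
        (M / 2 ^+ k * (kmass al * (r - n%:R * d) `^ al))%:E)%E.
      apply: conv_ker_bound => //.
      - by move=> x xn /=; rewrite IH// ltW.
      - by move=> x _ xr; rewrite lee_fin; apply: IHk; exact: le_trans (ltW xr) rnd.
    have : ((w r)%:E <= (K * (M / 2 ^+ k * (kmass al * (r - n%:R * d) `^ al)))%:E)%E.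
      by apply: le_trans (hw r) _; rewrite EFinM; apply: lee_wpmul2l; rewrite ?lee_fin.
    rewrite lee_fin => /le_trans; apply.
    rewrite mulrCA exprSr invfM [leRHS]mulrA; apply: ler_wpM2l => //.
    apply: le_trans KD; rewrite ler_wpM2l// ler_wpM2l//.
    rewrite ge0_ler_powR ?nnegrE ?subr_ge0//; [exact: ltW|exact: ltW|].
    by rewrite lerBlDl.
  apply/eqP; rewrite eq_le; have /andP[-> _] := wM s; rewrite andbT.
  rewrite leNgt; apply/negP => ws.
  pose N := (Num.truncn (M / w s)).+1.
  have := half N s snd; rewrite ler_pdivlMr ?exprn_gt0// mulrC -ler_pdivlMr//.
  apply/negP; rewrite -ltNge.
  apply: (lt_trans (truncnS_gt _)).
  by rewrite -natrX ltr_nat ltn_expl.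
move=> t; have [N hN] : exists N : nat, t <= N%:R * d.
  exists (Num.truncn (t / d)).+1; rewrite -ler_pdivrMr//.
  exact/ltW/truncnS_gt.
exact: vanish hN.
Qed.

End caputo_conv.

(** * Solutions satisfy the Volterra equation *)

Section solution_volterra.
Context {R : realType}.
Notation mu := (@lebesgue_measure R).

Lemma equicontinuous_within (A : set R) (h : R -> R) :
  (forall e : R, 0 < e -> exists2 d : R, 0 < d &
    forall t t', A t -> A t' -> `|t' - t| < d -> `|h t' - h t| < e) ->
  {within A, continuous h}.
Proof.
move=> H; apply/subspace_continuousP => x Ax.
apply/cvgrPdist_lt => e e0; have [d d0 Hd] := H e e0.
rewrite near_withinE; near=> y => Ay.
by rewrite distrC; apply: Hd => //; rewrite distrC; near: y; exact: nbhsx_ballx.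
Unshelve. all: by end_near. Qed.

(** Where [v t > 0] the power is differentiable. Where [v t = 0] the radius [e ^ (1 / p)] works
    directly, and nonnegativity near [t] excludes the junk values of [powR]. *)
Lemma nonneg_powR_continuous (p t : R) (v : R -> R) : 0 < p ->
  (\forall s \near t, 0 <= v s) -> {for t, continuous v} ->
  {for t, continuous (fun s => v s `^ p)}.
Proof.
move=> p0 nv cv; have vt0 : 0 <= v t := nbhs_singleton nv.
have [vt|vt] := eqVneq (v t) 0; last first.
  have vtp : 0 < v t by rewrite lt_neqAle eq_sym vt.
  apply: (@continuous_comp _ _ _ v (fun y => y `^ p)) => //.
  apply: differentiable_continuous; apply/derivable1_diffP.
  by have [] := @is_derive1_powR _ p _ vtp.
apply/cvgrPdist_lt => e e0.
have e1 : 0 < e `^ p^-1 by rewrite powR_gt0.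
move/cvgrPdist_lt : cv => /(_ _ e1) cv'.
rewrite vt powR0 ?gt_eqF//.
near=> s; rewrite sub0r normrN ger0_norm ?powR_ge0//.
have vs0 : 0 <= v s by near: s.
have : v s < e `^ p^-1.
  have : `|v t - v s| < e `^ p^-1 by near: s.
  by rewrite vt sub0r normrN ger0_norm.
move=> /(gt0_ltr_powR p0 _ _) H.
have := H vs0 (ltW e1); rewrite -powRrM mulVf ?gt_eqF// powRr1//; exact: ltW.
Unshelve. all: by end_near. Qed.

Context (al p u0 T : R) (S : \bar R) (v : R -> R).
Hypotheses (al0 : 0 < al) (al1 : al < 1) (p0 : 0 < p) (u0_ge0 : 0 <= u0).
Hypotheses (sv : is_solution al p u0 S v) (T0 : 0 < T) (TS : (T%:E < S)%E).

Let ltS t : t <= T -> (t%:E < S)%E.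
Proof. by move=> tT; apply: le_lt_trans TS; rewrite lee_fin. Qed.

Lemma solution_within : {within `[0, T], continuous v}.
Proof.
have [_ cv _ _ _] := sv; apply: continuous_subspaceW cv => t /=.
by rewrite in_itv/= => /andP[t0 tT]; split => //; exact: ltS.
Qed.

Lemma solution_ge0 t : 0 <= t -> t <= T -> 0 <= v t.
Proof. by have [_ _ v0 _ _] := sv => t0 tT; apply: v0 => //; exact: ltS. Qed.

Lemma solution_bounded : exists M, forall t, 0 <= t -> t <= T -> v t <= M.
Proof.
have [c _ H] := EVT_max (ltW T0) solution_within.
by exists (v c) => t t0 tT; apply: H; rewrite in_itv/= t0.
Qed.

Lemma solution_measurable : measurable_fun (`[0, T] : set R) v.
Proof. by apply: subspace_continuous_measurable_fun => //; exact: solution_within. Qed.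

Lemma solution_continuous t : 0 < t -> t < T -> {for t, continuous v}.
Proof.
move=> t0 tT; apply: (within_continuous_continuous T0 solution_within).
by rewrite in_itv/= t0.
Qed.

(** On the compact [[0, T]] a solution is bounded; the cutoff produces bounded functions on the line
    that vanish at negative times, as the convolution estimates require. *)
Definition cut (h : R -> R) : R -> R := h \_ `[0, T].

Lemma cutE h t : 0 <= t -> t <= T -> cut h t = h t.
Proof. by move=> t0 tT; rewrite /cut patchE mem_setE in_itv/= t0 tT. Qed.

Lemma cut_lt0 h t : t < 0 -> cut h t = 0.
Proof. by move=> t0; rewrite /cut patchE mem_setE in_itv/= leNgt t0. Qed.

Lemma cut_bounds h M : 0 <= M ->
  (forall t, 0 <= t -> t <= T -> 0 <= h t <= M) -> forall t, 0 <= cut h t <= M.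
Proof.
move=> M0 hM t; rewrite /cut patchE mem_setE in_itv/=.
by case: ifPn => [/andP[t0 tT]|_]; [exact: hM|rewrite lexx].
Qed.

Lemma measurable_cut h : measurable_fun (`[0, T] : set R) h ->
  measurable_fun [set: R] (cut h).
Proof. by move=> mh; exact: (measurable_restrictT h (measurable_itv _)).1. Qed.

Lemma cut_continuous h t : 0 < t -> t < T -> {for t, continuous h} ->
  {for t, continuous (cut h)}.
Proof.
move=> t0 tT ch; rewrite /prop_for /continuous_at cutE ?ltW//.
apply: cvg_trans ch; apply: near_eq_cvg; near=> s.
rewrite cutE//.
- by apply/ltW; near: s; exact: lt_nbhsr.
- by apply/ltW; near: s; exact: lt_nbhsl.
Unshelve. all: by end_near. Qed.

(** [v - u0] may a priori change sign, so the integral is split into a difference of two finite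
    convolutions of nonnegative functions. *)
Lemma caputo_primitive_conv t : 0 <= t -> t <= T ->
  Gamma (1 - al) * caputo_primitive al v t =
  fine (conv (ker (1 - al)) (EFin \o cut v) t) -
  u0 * fine (conv (ker (1 - al)) (EFin \o cut (cst 1)) t).
Proof.
move=> t0 tT; have [M vM] := solution_bounded.
have M0 : 0 <= M := le_trans (solution_ge0 (lexx 0) (ltW T0)) (vM _ (lexx 0) (ltW T0)).
have mv : measurable_fun [set: R] (cut v).
  by apply: measurable_cut; exact: solution_measurable.
have bv : forall s, 0 <= cut v s <= M.
  by apply: cut_bounds => // s s0 sT; rewrite solution_ge0//= vM.
have m1 : measurable_fun [set: R] (cut (cst 1)).
  by apply: measurable_cut; exact: measurable_cst.
have b1 : forall s, 0 <= cut (cst 1) s <= 1.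
  by apply: cut_bounds => // s _ _; rewrite /cst lexx ler01.
have [_ _ _ v0 _] := sv.
rewrite /caputo_primitive mulrA mulfV ?gt_eqF ?Gamma_inv_gt0// mul1r v0.
have mK : measurable_fun [set: R] (fun s => (t - s) `^ (- al)).
  apply: (@measurableT_comp _ _ _ _ _ _ (@powR R ^~ (- al))) => //.
  exact: measurable_funB.
have E (h : R -> R) : (\int[mu]_(s in `[0%R, t]) ((t - s) `^ (- al) * h s)%:E)%E =
    conv (ker (1 - al)) (EFin \o cut h) t.
  rewrite conv_ker_itv ?gt_eqF//; apply: eq_conv_ker => s st /=.
  by case: leP => s0; [rewrite cutE// (le_trans (ltW st))|rewrite cut_lt0].
have I (h : R -> R) M' : 0 <= M' -> measurable_fun [set: R] (cut h) ->
    (forall s, 0 <= s -> s <= T -> 0 <= h s <= M') ->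
    mu.-integrable `[0, t] (EFin \o (fun s => (t - s) `^ (- al) * h s)).
  move=> M'0 mh hM; apply/integrableP; split.
    apply/measurable_EFinP; apply: measurable_funM; first exact: measurable_funTS.
    apply: (eq_measurable_fun (cut h)); last exact: measurable_funTS.
    move=> s; rewrite inE/= in_itv/= => /andP[s0 st].
    by rewrite cutE// (le_trans st).
  rewrite (@eq_integral _ _ _ mu _ (fun s => ((t - s) `^ (- al) * h s)%:E)).
    rewrite E (@conv_ker_fin _ M')//; first exact: ltry.
    - exact: cut_bounds.
    - by move=> s s0; exact: cut_lt0.
    - by rewrite subr_gt0.
  move=> s; rewrite inE/= in_itv/= => /andP[s0 st] /=.
  have /andP[hs _] := hM s s0 (le_trans st tT).
  by rewrite ger0_norm// mulr_ge0// powR_ge0.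
rewrite (@eq_Rintegral _ _ _ mu _
  (fun s => (t - s) `^ (- al) * v s - (t - s) `^ (- al) * (u0 * cst 1 s))); last first.
  by move=> s _; rewrite mulr1 mulrBr.
have i1 := I v M M0 mv
  (fun s s0 sT => introT andP (conj (solution_ge0 s0 sT) (vM s s0 sT))).
have Z : (fun s => (t - s) `^ (- al) * (u0 * cst 1 s)) =
     (fun s => u0 * ((t - s) `^ (- al) * cst 1 s)).
  by apply/funext => s; ring.
have i1' := I (cst 1) 1 ler01 m1 (fun s _ _ => introT andP (conj ler01 (lexx 1))).
have i2 : mu.-integrable `[0, t] (EFin \o (fun s => (t - s) `^ (- al) * (u0 * cst 1 s))).
  rewrite Z.
  have := @integrableZl _ _ _ mu _ (measurable_itv _) u0 _ i1'.
  by apply: eq_integrable => // s _; rewrite /= EFinM.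
rewrite RintegralB// Z RintegralZl// /Rintegral.
by congr (fine _ - _ * fine _); exact: E.
Qed.

Lemma fine_conv_equicontinuous a (M : R) (h : R -> R) t : 0 < a -> a <= 1 ->
  measurable_fun [set: R] h -> (forall x, 0 <= h x <= M) ->
  (forall x, x < 0 -> h x = 0) ->
  {within `[0, t], continuous (fun t => fine (conv (ker a) (EFin \o h) t))}.
Proof.
move=> a0 a1 mh hM h0; apply: equicontinuous_within => e e0.
have [d d0 H] := conv_ker_equicontinuous a0 a1 mh hM h0 e0.
exists d => // s s'; rewrite /= !in_itv/= => /andP[s0 _] /andP[s'0 _].
exact: H.
Qed.

Lemma solution_power_bounds : exists2 M, 0 <= M &
  forall t, 0 <= cut (fun s => v s `^ p) t <= M.
Proof.
have [M vM] := solution_bounded.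
have M0 : 0 <= M := le_trans (solution_ge0 (lexx 0) (ltW T0)) (vM _ (lexx 0) (ltW T0)).
exists (M `^ p); first exact: powR_ge0.
apply: cut_bounds; first exact: powR_ge0.
move=> t t0 tT; rewrite powR_ge0/= ge0_ler_powR ?nnegrE ?solution_ge0//; first exact: ltW.
exact: vM.
Qed.

Lemma measurable_solution_power : measurable_fun [set: R] (cut (fun s => v s `^ p)).
Proof.
apply: measurable_cut.
apply: (@measurableT_comp _ _ _ _ _ _ (@powR R ^~ p)) => //.
exact: solution_measurable.
Qed.

Lemma solution_power_continuous t : 0 < t -> t < T ->
  {for t, continuous (cut (fun s => v s `^ p))}.
Proof.
move=> t0 tT; apply: cut_continuous => //; apply: nonneg_powR_continuous => //.
  near=> s; apply: solution_ge0.
  - by apply/ltW; near: s; exact: lt_nbhsr.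
  - by apply/ltW; near: s; exact: lt_nbhsl.
exact: solution_continuous.
Unshelve. all: by end_near. Qed.

Let f := cut (fun s => v s `^ p).
Let g := cut v.
Let one : R -> R := cut (cst 1).

Let mf : measurable_fun [set: R] f. Proof. exact: measurable_solution_power. Qed.
Let mg : measurable_fun [set: R] g.
Proof. by apply: measurable_cut; exact: solution_measurable. Qed.
Let m1 : measurable_fun [set: R] one.
Proof. by apply: measurable_cut; exact: measurable_cst. Qed.
Let f_lt0 x : x < 0 -> f x = 0. Proof. exact: cut_lt0. Qed.
Let g_lt0 x : x < 0 -> g x = 0. Proof. exact: cut_lt0. Qed.
Let one_lt0 x : x < 0 -> one x = 0. Proof. exact: cut_lt0. Qed.
Let one_bnd x : 0 <= one x <= 1.
Proof. by apply: cut_bounds => // s _ _; rewrite /cst lexx ler01. Qed.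
Let g_bnd : exists M, forall t, 0 <= g t <= M.
Proof.
have [M vM] := solution_bounded.
have M0 : 0 <= M := le_trans (solution_ge0 (lexx 0) (ltW T0)) (vM _ (lexx 0) (ltW T0)).
by exists M; apply: cut_bounds => // s s0 sT; rewrite solution_ge0//= vM.
Qed.

(* Both sides have derivative Gamma (1 - al) * v ^ p on ]0, T[, are continuous,
   and vanish at 0. *)
Lemma solution_primitive t : 0 <= t -> t < T ->
  Gamma (1 - al) * fine (conv (ker 1) (EFin \o f) t) =
  fine (conv (ker (1 - al)) (EFin \o g) t) -
  u0 * fine (conv (ker (1 - al)) (EFin \o one) t).
Proof.
move=> t0 tT; have [M M0 fM] := solution_power_bounds; have [M' gM] := g_bnd.
have G0 : 0 < Gamma (1 - al) by exact: Gamma_inv_gt0.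
have a0 : 0 < 1 - al by rewrite subr_gt0.
have a1 : 1 - al <= 1 by rewrite gerBl ltW.
move: t0; rewrite le_eqVlt => /predU1P[<-|t0].
  by rewrite !conv_ker_le0//= !mulr0 subrr.
pose I x := fine (conv (ker 1) (EFin \o f) x).
pose A x := fine (conv (ker (1 - al)) (EFin \o g) x).
pose B x := fine (conv (ker (1 - al)) (EFin \o one) x).
pose K x := (A x - u0 * B x) - Gamma (1 - al) * I x.
suff : K t = 0 by rewrite /K => /eqP; rewrite subr_eq0 => /eqP ->.
have K0 : K 0 = 0 by rewrite /K /A /B /I !conv_ker_le0//= !mulr0 !subrr.
have [||c _] := @MVT R K (cst 0) 0 t t0; last first.
- by rewrite K0 subr0 mul0r.
- apply/subspace_continuousP => x xt.
  have cA : {within `[0, t], continuous A} by exact: (@fine_conv_equicontinuous _ M').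
  have cB : {within `[0, t], continuous B} by exact: (@fine_conv_equicontinuous _ 1).
  have cI : {within `[0, t], continuous I} by exact: (@fine_conv_equicontinuous _ M).
  move/subspace_continuousP : cA => /(_ x xt) cA.
  move/subspace_continuousP : cB => /(_ x xt) cB.
  move/subspace_continuousP : cI => /(_ x xt) cI.
  apply: cvgB; first by apply: cvgB => //; exact: cvgMr.
  exact: cvgMr.
- move=> x; rewrite in_itv/= => /andP[x0 xt].
  have xT := lt_trans xt tT.
  have [_ _ _ _ /(_ x x0 (ltS (ltW xT)))[dG eG]] := sv.
  have dI : is_derive x 1 I (f x).
    exact: (is_derive_conv_ker1 mf fM f_lt0 x0 (solution_power_continuous x0 xT)).
  have dC : is_derive x 1 (caputo_primitive al v) (f x).
    apply: DeriveDef; first exact: dG.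
    by rewrite -derive1E -/(caputo al v x) eG /f cutE// ltW.
  have dK : is_derive x 1
      (fun y => Gamma (1 - al) * caputo_primitive al v y - Gamma (1 - al) * I y)
      (Gamma (1 - al) * f x - Gamma (1 - al) * f x).
    apply: is_deriveB; exact: is_deriveZ.
  rewrite subrr in dK; apply: near_eq_is_derive dK.
  near=> y; rewrite /K caputo_primitive_conv//.
  + by apply/ltW; near: y; exact: lt_nbhsr.
  + by apply/ltW; near: y; exact: lt_nbhsl.
Unshelve. all: by end_near. Qed.

(** The right-hand side of the Volterra equation for [v], to be identified with [g]. *)
Let j := cut (fun s => u0 + rl_coef al * fine (conv (ker al) (EFin \o f) s)).

Let j_lt0 x : x < 0 -> j x = 0. Proof. exact: cut_lt0. Qed.

Let EF_ge0 (h : R -> R) M : (forall x, 0 <= h x <= M) ->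
  forall x, (0 <= (EFin \o h) x)%E.
Proof. by move=> hM x; rewrite lee_fin; have /andP[] := hM x. Qed.

Let mj : measurable_fun [set: R] j.
Proof.
have [M M0 fM] := solution_power_bounds.
apply: measurable_cut; apply: measurable_funTS; apply: measurable_funD => //.
apply: measurable_funM => //; apply: (@measurableT_comp _ _ _ _ _ _ fine) => //.
apply: measurable_conv => //; first exact/measurable_EFinP.
exact: EF_ge0 fM.
Qed.

Let j_bnd : exists M, forall t, 0 <= j t <= M.
Proof.
have [M M0 fM] := solution_power_bounds.
have c0 := ltW (rl_coef_gt0 al0 al1).
have N0 : 0 <= M * (kmass al * T `^ al).
  by rewrite mulr_ge0// mulr_ge0 ?powR_ge0 ?kmass_ge0.
exists (u0 + rl_coef al * (M * (kmass al * T `^ al))).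
apply: cut_bounds; first by rewrite addr_ge0// mulr_ge0.
move=> t t0 tT; apply/andP; split.
  by rewrite addr_ge0// mulr_ge0// fine_ge0// conv_ge0//; exact: EF_ge0 fM.
rewrite lerD2l ler_wpM2l// -lee_fin -(conv_ker_fin mf fM f_lt0)//.
apply: (@le_trans _ _ (M * (kmass al * (t - 0) `^ al))%:E).
  apply: conv_ker_bound => //.
  - exact/measurable_EFinP.
  - exact: EF_ge0 fM.
  - by move=> x x0; rewrite /= f_lt0.
  - by move=> x _ _; rewrite lee_fin; have /andP[] := fM x.
rewrite lee_fin subr0 ler_wpM2l// ler_wpM2l ?kmass_ge0//.
by rewrite ge0_ler_powR ?nnegrE// ltW.
Qed.

(** Convolving [solution_primitive] with [ker al] turns the terms in [ker (1 - al)] into [kbeta al]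
    times ordinary integrals; dividing by [kbeta al] leaves [Gamma (1 - al) / kbeta al], that is
    [rl_coef al], in front of the term in [f]. *)
Let primitive_eq t : t < T ->
  conv (ker 1) (EFin \o g) t = conv (ker 1) (EFin \o j) t.
Proof.
move=> tT; have [M M0 fM] := solution_power_bounds; have [M' gM] := g_bnd.
have [M'' jM] := j_bnd.
have b0 := kbeta_gt0 al0 al1; have c0 := ltW (rl_coef_gt0 al0 al1).
have G0 := ltW (Gamma_inv_gt0 al0 al1).
have mF : measurable_fun [set: R] (EFin \o f) by exact/measurable_EFinP.
have mG : measurable_fun [set: R] (EFin \o g) by exact/measurable_EFinP.
have mO : measurable_fun [set: R] (EFin \o one) by exact/measurable_EFinP.
have F0 := EF_ge0 fM; have H0 := EF_ge0 gM; have O0 := EF_ge0 one_bnd.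
pose Df := conv (ker 1) (EFin \o f).
pose Dg := conv (ker (1 - al)) (EFin \o g).
pose D1 := conv (ker (1 - al)) (EFin \o one).
have mDf : measurable_fun [set: R] Df by exact: measurable_conv.
have mDg : measurable_fun [set: R] Dg by exact: measurable_conv.
have mD1 : measurable_fun [set: R] D1 by exact: measurable_conv.
have Df0 x : (0 <= Df x)%E by exact: conv_ge0.
have Dg0 x : (0 <= Dg x)%E by exact: conv_ge0.
have D10 x : (0 <= D1 x)%E by exact: conv_ge0.
(* The subtracted term of [solution_primitive] changes sides, so that only nonnegative functions get
   convolved. *)
have E s : s < T -> Dg s = ((Gamma (1 - al))%:E * Df s + u0%:E * D1 s)%E.
  move=> sT; have [s0|s0] := leP s 0.
    by rewrite /Dg /Df /D1 !conv_ker_le0// !mule0 adde0.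
  have := solution_primitive (ltW s0) sT.
  have a0 : 0 < 1 - al by rewrite subr_gt0.
  rewrite /Dg /Df /D1 (conv_ker_fin mg gM g_lt0 _ a0) (conv_ker_fin m1 one_bnd one_lt0 _ a0).
  rewrite (conv_ker_fin mf fM f_lt0 _ ltr01) -!EFinM -EFinD => ->.
  by rewrite subrK.
have swap (F : R -> \bar R) : measurable_fun [set: R] F -> (forall x, 0 <= F x)%E ->
    conv (ker al) (conv (ker (1 - al)) F) t = ((kbeta al)%:E * conv (ker 1) F t)%E.
  move=> mF' F'0; rewrite -conv_ker_ker// !convA//; congr (conv _ F t).
  exact: convC.
have swap1 : conv (ker al) Df t = conv (ker 1) (conv (ker al) (EFin \o f)) t.
  by rewrite /Df !convA//; congr (conv _ _ t); exact: convC.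
have mC : measurable_fun [set: R] (conv (ker al) (EFin \o f)) by exact: measurable_conv.
have C0 x : (0 <= conv (ker al) (EFin \o f) x)%E by exact: conv_ge0.
have : ((kbeta al)%:E * conv (ker 1) (EFin \o g) t =
    (kbeta al)%:E * conv (ker 1) (EFin \o j) t)%E.
  rewrite -swap// -/Dg.
  rewrite (@eq_conv_ker _ _ _
    (fun s => (Gamma (1 - al))%:E * Df s + u0%:E * D1 s)%E); last first.
    by move=> s st; apply: E; exact: lt_trans tT.
  rewrite convDr//; last 4 first.
  - exact: emeasurable_funM.
  - exact: emeasurable_funM.
  - by move=> x; rewrite mule_ge0.
  - by move=> x; rewrite mule_ge0.
  rewrite !convZr// swap1 swap//.
  rewrite (@eq_conv_ker _ 1 (EFin \o j)
    (fun s => (rl_coef al)%:E * conv (ker al) (EFin \o f) s +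
      u0%:E * (EFin \o one) s)%E); last first.
    move=> s st /=; have sT := ltW (lt_trans st tT).
    have [s0|s0] := leP 0 s; last first.
      by rewrite j_lt0// one_lt0// (conv_ker_le0 f_lt0) ?ltW// !mule0 adde0.
    by rewrite /j /one !cutE// mule1 EFinD EFinM addeC -(conv_ker_fin mf fM f_lt0).
  rewrite convDr//; last 4 first.
  - exact: emeasurable_funM.
  - exact: emeasurable_funM.
  - by move=> x; rewrite mule_ge0.
  - by move=> x; rewrite mule_ge0.
  rewrite !convZr// ge0_muleDr; last 2 first.
  - by rewrite mule_ge0// conv_ge0.
  - by rewrite mule_ge0// conv_ge0.
  rewrite [in RHS]muleA -[in RHS]EFinM /rl_coef mulrCA divff ?gt_eqF// mulr1.
  by congr (_ + _)%E; rewrite muleCA.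
(* Both integrals are finite, so the equation descends to [R], where [kbeta al] cancels. *)
rewrite (conv_ker_fin mg gM g_lt0 _ ltr01) (conv_ker_fin mj jM j_lt0 _ ltr01) -!EFinM.
by move=> [] /(mulfI (lt0r_neq0 b0)) ->.
Qed.

(** The primitives of [g] and [j] agree near [t] and both integrands are continuous at [t], so
    comparing derivatives gives [g t = j t]. Time 0 is the initial condition. *)
Lemma solution_volterra t : 0 <= t -> t < T ->
  v t = u0 + rl_coef al * fine (conv (ker al) (EFin \o cut (fun s => v s `^ p)) t).
Proof.
have [M M0 fM] := solution_power_bounds; have [M' gM] := g_bnd.
have [M'' jM] := j_bnd.
rewrite le_eqVlt => /predU1P[<- _|t0 tT].
  have [_ _ _ -> _] := sv.
  by rewrite (conv_ker_le0 f_lt0)// mulr0 addr0.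
pose h s := u0 + rl_coef al * fine (conv (ker al) (EFin \o f) s).
have ch : {for t, continuous h}.
  apply: (@within_continuous_continuous _ _ _ 0 T); rewrite ?in_itv/= ?t0//.
  apply: equicontinuous_within => e e0.
  have [d d0 H] := @volterra_equicontinuous _ al u0 M T f h al0 al1 mf fM f_lt0
    (fun _ _ _ => erefl) e e0.
  exists d => // s s'; rewrite /= !in_itv/= => /andP[s0 sT] /andP[s'0 s'T].
  exact: H.
have dg : is_derive t 1 (fun t => fine (conv (ker 1) (EFin \o g) t)) (g t).
  apply: (is_derive_conv_ker1 mg gM g_lt0 t0); apply: cut_continuous => //.
  exact: solution_continuous.
have dj : is_derive t 1 (fun t => fine (conv (ker 1) (EFin \o j) t)) (j t).
  by apply: (is_derive_conv_ker1 mj jM j_lt0 t0); exact: cut_continuous.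
have dj' : is_derive t 1 (fun t => fine (conv (ker 1) (EFin \o g) t)) (j t).
  apply: near_eq_is_derive dj; near=> s; rewrite primitive_eq//.
  by near: s; exact: lt_nbhsl.
have gj : g t = j t by have [_ <-] := dg; have [_ e] := dj'; exact: e.
have gE : g t = v t by rewrite /g cutE// ltW.
have jE : j t = h t by rewrite /j cutE// ltW.
by rewrite -gE gj jE.
Unshelve. all: by end_near. Qed.

End solution_volterra.

(** * Uniqueness and blow-up *)

Section lipschitz.
Context {R : realType}.

(** Bernoulli's inequality for [1 - r]. *)
Lemma bernoulli_onem (r : R) (n : nat) : 0 <= r -> r <= 1 ->
  1 - r ^+ n <= n%:R * (1 - r).
Proof.
move=> r0 r1; elim: n => [|n IH]; first by rewrite expr0 subrr mul0r.
have rn : r ^+ n <= 1 by rewrite exprn_ile1.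
have rn0 : 0 <= r ^+ n by rewrite exprn_ge0.
rewrite exprSr -natr1 mulrDl mul1r; move: (r ^+ n) (n%:R * (1 - r)) IH rn rn0 => y z.
by move=> IH y1 y0; nra.
Qed.

(** By homogeneity it suffices to bound [1 - r ^ p] for the ratio [r = x / y] in [[0, 1]]; since
    [r ^ n <= r ^ p], the integer power and Bernoulli do so, with [n] in place of the sharp constant
    [p]. *)
Lemma powR_lipschitz (p x y M : R) (n : nat) : 1 <= p -> p <= n%:R ->
  0 <= x -> x <= y -> y <= M ->
  y `^ p - x `^ p <= n%:R * M `^ (p - 1) * (y - x).
Proof.
move=> p1 pn x0 xy yM; have p0 : 0 < p by exact: lt_le_trans p1.
have [y0|y0] := leP y 0.
  have E : y = x by apply/le_anti; rewrite xy andbT (le_trans y0).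
  by rewrite E !subrr mulr0.
pose r := x / y.
have r0 : 0 <= r by rewrite divr_ge0// ltW.
have r1 : r <= 1 by rewrite ler_pdivrMr// mul1r.
have xE : x = y * r by rewrite /r mulrCA divff ?mulr1// gt_eqF.
have rpn : r ^+ n <= r `^ p.
  have [->|rn0] := eqVneq r 0.
    have n0 : (0 < n)%N by rewrite -(ltr_nat R); exact: lt_le_trans pn.
    by rewrite expr0n gtn_eqF// powR_ge0.
  by rewrite -powR_mulrn//; apply: ger_powR => //; rewrite lt_neqAle eq_sym rn0 r0.
have B := bernoulli_onem n r0 r1.
rewrite xE (powRM p (ltW y0) r0).
have yp : y `^ p = y `^ (p - 1) * y by rewrite mulrC mulr_powRB1// ltW.
have yM1 : y `^ (p - 1) <= M `^ (p - 1).
  by rewrite ge0_ler_powR ?subr_ge0// nnegrE ltW// (lt_le_trans y0).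
apply: (@le_trans _ _ (y `^ p * (n%:R * (1 - r)))).
  rewrite -[X in X - _]mulr1 -mulrBr ler_wpM2l ?powR_ge0//.
  by apply: le_trans B; rewrite lerD2l lerN2.
have -> : y - y * r = y * (1 - r) by ring.
rewrite yp.
have -> : y `^ (p - 1) * y * (n%:R * (1 - r)) =
    y `^ (p - 1) * (n%:R * (y * (1 - r))) by ring.
have -> : n%:R * M `^ (p - 1) * (y * (1 - r)) =
    M `^ (p - 1) * (n%:R * (y * (1 - r))) by ring.
by rewrite ler_wpM2r// !mulr_ge0 ?subr_ge0// ltW.
Qed.

End lipschitz.

Section main.
Context {R : realType}.
Context (u0 p al : R).
Hypotheses (u0_gt0 : 0 < u0) (p_gt1 : 1 < p) (al0 : 0 < al) (al1 : al < 1).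

Let c := rl_coef al.
Let c_gt0 : 0 < c. Proof. exact: rl_coef_gt0. Qed.
Let p_gt0 : 0 < p. Proof. exact: lt_trans p_gt1. Qed.
Let al_le1 : al <= 1. Proof. exact: ltW. Qed.
Let ms : R -> \bar R := minsol u0 p al c.
Let Tm := blowup_time u0 p al c.

Let ms_ge0 t : (0 <= ms t)%E. Proof. exact: minsol_ge0. Qed.
Let measurable_ms : measurable_fun [set: R] ms. Proof. exact: measurable_minsol. Qed.
Let ms_le0 t : t <= 0 -> ms t = 0%E. Proof. exact: minsol_le0. Qed.
Let ms_mono s t : s <= t -> (ms s <= ms t)%E. Proof. exact: minsol_mono. Qed.
Let msE t : 0 < t ->
  ms t = (u0%:E + c%:E * conv (ker al) (fun s => ms s `^ p) t)%E.
Proof. by move=> t0; rewrite [LHS]minsolE// volterraE. Qed.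

Lemma lte_dense_real (t : R) (S : \bar R) : (t%:E < S)%E ->
  exists2 T : R, t < T & (T%:E < S)%E.
Proof.
case: S => [s| |] //; last by exists (t + 1); rewrite ?ltrDl ?ltry.
by rewrite lte_fin => ts; exists ((t + s) / 2); rewrite ?lte_fin midf_lt.
Qed.

(** * Every solution agrees with the minimal one *)

Section uniqueness.
Context (S : \bar R) (v : R -> R).
Hypothesis sv : is_solution al p u0 S v.

Lemma solution_minsol t : 0 < t -> (t%:E < S)%E -> ms t = (v t)%:E.
Proof.
move=> t0 tS; have [T tT TS] := lte_dense_real tS; have T0 := lt_trans t0 tT.
have u00 := ltW u0_gt0.
have [M0 M0ge fM] := solution_power_bounds p_gt0 sv T0 TS.
have [M vM] := solution_bounded sv T0 TS.
have v0 := solution_ge0 sv TS.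
pose f := cut T (fun s => v s `^ p); pose g := cut T v.
have mf : measurable_fun [set: R] f by exact: (measurable_solution_power sv TS).
have mg : measurable_fun [set: R] g.
  by apply: measurable_cut; exact: (solution_measurable sv TS).
have f_lt0 x : x < 0 -> f x = 0 by exact: cut_lt0.
have vE s : 0 < s -> s < T ->
    (v s)%:E = (u0%:E + c%:E * conv (ker al) (EFin \o f) s)%E.
  move=> s0 sT; rewrite (conv_ker_fin mf fM f_lt0)// -EFinM -EFinD.
  by rewrite (solution_volterra al0 al1 p_gt0 u00 sv T0 TS (ltW s0) sT).
have g0 x : (0 <= (EFin \o g) x)%E.
  rewrite lee_fin /g /cut patchE mem_setE in_itv/=.
  by case: ifPn => // /andP[x0 xT]; exact: v0.
have le_ms s : s < T -> (ms s <= (g s)%:E)%E.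
  move=> sT; apply: (@minsol_le_super _ u0 p al c u0_gt0 p_gt1 c_gt0
    (EFin \o g) T _ g0 _ s sT).
    exact/measurable_EFinP.
  move=> r r0 rT; rewrite volterraE /= {2}/g (cutE _ (ltW r0) (ltW rT)) vE//.
  rewrite (@eq_conv_ker _ _ _ (EFin \o f))// => x xr.
  rewrite /= /f /g; have [x0|x0] := ltP x 0.
    by rewrite !cut_lt0// powR0// gt_eqF.
  by rewrite !cutE// ltW// (lt_trans xr).
have ms_fin s : s < T -> ms s = (fine (ms s))%:E.
  by move=> /le_ms sT; rewrite fineK// ge0_fin_numE//; apply: le_lt_trans sT (ltry _).
(* The excess over the minimal solution, nonnegative by [le_ms]. It is set to 0 outside []0, T[] so
   that [conv_gronwall], stated for all times, applies. *)
pose w s := if (0 < s) && (s < T) then g s - fine (ms s) else 0.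
have wE s : 0 < s -> s < T -> w s = v s - fine (ms s).
  by move=> s0 sT; rewrite /w s0 sT/= /g cutE// ltW.
have mw : measurable_fun [set: R] w.
  apply: measurable_fun_ifT => //.
    by apply: measurable_and; exact: measurable_fun_ltr.
  by apply: measurable_funB => //; exact: (@measurableT_comp _ _ _ _ _ _ fine).
have Mge0 : 0 <= M := le_trans (v0 _ (lexx 0) (ltW T0)) (vM _ (lexx 0) (ltW T0)).
have wM s : 0 <= w s <= M.
  rewrite /w; case: ifPn => [/andP[s0 sT]|_]; last by rewrite lexx.
  have := le_ms s sT; rewrite ms_fin// lee_fin => h; rewrite subr_ge0 h/=.
  apply: (@le_trans _ _ (g s)); first by rewrite gerBl fine_ge0.
  by rewrite /g cutE ?vM// ltW.
have w_le0 s : s <= 0 -> w s = 0 by rewrite /w ltNge => ->.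
pose n := (Num.truncn p).+1.
have pn : p <= n%:R by exact/ltW/truncnS_gt.
pose L := n%:R * M `^ (p - 1).
have L0 : 0 <= L by rewrite mulr_ge0// powR_ge0.
have mW : measurable_fun [set: R] (EFin \o w) by exact/measurable_EFinP.
have W0 x : (0 <= (EFin \o w) x)%E by rewrite lee_fin; have /andP[] := wM x.
have w_lt0 x : x < 0 -> w x = 0 by move=> /ltW; exact: w_le0.
have mmp : measurable_fun [set: R] (fun s => ms s `^ p)%E.
  exact: (measurableT_comp (measurable_poweR p)).
have wgron s : ((w s)%:E <= (c * L)%:E * conv (ker al) (EFin \o w) s)%E.
  have cw0 : (0 <= (c * L)%:E * conv (ker al) (EFin \o w) s)%E.
    apply: mule_ge0; last exact: conv_ge0.
    by rewrite lee_fin mulr_ge0// ltW.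
  have [s0|s0] := leP s 0; first by rewrite w_le0.
  have [Ts|sT] := leP T s; first by rewrite /w [s < T]ltNge Ts andbF.
  have key : (conv (ker al) (EFin \o f) s <=
      conv (ker al) (fun x => ms x `^ p) s + L%:E * conv (ker al) (EFin \o w) s)%E.
    rewrite -convZr// -convDr//; first last.
    - by move=> x; rewrite mule_ge0.
    - by move=> x; exact: poweR_ge0.
    - exact: emeasurable_funM.
    (* The pointwise inequality fails at 0, where [f] is [u0 ^ p] while [ms] and [w] are 0. *)
    apply: (@le_conv_except _ _ _ _ _ 0) => //.
    - exact/measurable_EFinP.
    - by apply: emeasurable_funD => //; exact: emeasurable_funM.
    - by move=> x; rewrite lee_fin; have /andP[] := fM x.
    - by move=> x; rewrite adde_ge0 ?poweR_ge0// mule_ge0.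
    move=> x x0 /ker_gt0; rewrite subr_gt0 => xs; have xT := lt_trans xs sT.
    have [x1|x1] := leP x 0.
      rewrite /= f_lt0; last by rewrite lt_neqAle x0.
      apply: adde_ge0; first exact: poweR_ge0.
      by rewrite -EFinM lee_fin mulr_ge0//; have /andP[] := wM x.
    rewrite (ms_fin x xT) /= -EFinM -EFinD lee_fin wE// /f (cutE _ (ltW x1) (ltW xT)).
    rewrite -lerBlDl; apply: powR_lipschitz; [exact: ltW|exact: pn|exact: fine_ge0| |].
      by have := le_ms x xT; rewrite ms_fin// lee_fin /g (cutE _ (ltW x1) (ltW xT)).
    by apply: vM; exact: ltW.
  rewrite wE// EFinB -(ms_fin s sT) leeBlDl; last by rewrite ms_fin.
  rewrite vE// msE//; apply: (@le_trans _ _ (u0%:E + c%:E *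
     (conv (ker al) (fun x => ms x `^ p) s + L%:E * conv (ker al) (EFin \o w) s)))%E.
    by rewrite leeD2l//; apply: lee_wpmul2l => //; rewrite lee_fin ltW.
  rewrite ge0_muleDr; last 2 first.
  - by apply: conv_ge0 => // x; exact: poweR_ge0.
  - by rewrite mule_ge0// conv_ge0.
  by rewrite addeA muleA -EFinM.
have := conv_gronwall al0 (mulr_ge0 (ltW c_gt0) L0) mw wM w_le0 wgron t.
rewrite wE// => /eqP; rewrite subr_eq0 => /eqP ->.
by rewrite -ms_fin.
Qed.

End uniqueness.

(** The case distinction restores the initial value, which [minsol] lacks at 0. Where [ms] is +oo,
    [fine] returns a junk 0. *)
Definition sol (t : R) : R := if 0 < t then fine (ms t) else u0.

Let ms_fin s : s < Tm -> ms s = (fine (ms s))%:E.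
Proof.
move=> sT; rewrite fineK// ge0_fin_numE//.
exact: (blowup_time_lt u0_gt0 p_gt1 al0 al_le1 c_gt0).
Qed.

(** * The minimal solution solves the Caputo problem *)

Section truncation.
Context (T : R).
Hypothesis TTm : T < Tm.

(** Cutting the source off after [T < Tm] makes it bounded on the whole line, by its value at [T],
    without changing the equation up to [T]. *)
Let f s := if s <= T then fine (ms s) `^ p else 0.

Let mf : measurable_fun [set: R] f.
Proof.
apply: measurable_fun_ifT => //; first exact: measurable_fun_ler.
apply: (@measurableT_comp _ _ _ _ _ _ (@powR R ^~ p)) => //.
exact: (@measurableT_comp _ _ _ _ _ _ fine).
Qed.

Let fM x : 0 <= f x <= fine (ms T) `^ p.
Proof.
rewrite /f; case: ifPn => [xT|_]; last by rewrite lexx powR_ge0.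
rewrite powR_ge0/= ge0_ler_powR ?nnegrE ?fine_ge0//; first exact: ltW.
rewrite -lee_fin -!ms_fin//; first exact: ms_mono.
exact: le_lt_trans TTm.
Qed.

Let f_lt0 x : x < 0 -> f x = 0.
Proof.
by move=> x0; rewrite /f (ms_le0 (ltW x0)) fine0 powR0 ?gt_eqF//; case: ifP.
Qed.

Let solE t : 0 <= t -> t <= T ->
  sol t = u0 + c * fine (conv (ker al) (EFin \o f) t).
Proof.
rewrite le_eqVlt => /predU1P[<- _|t0 tT].
  by rewrite /sol ltxx (conv_ker_le0 f_lt0)// mulr0 addr0.
apply: EFin_inj; rewrite /sol t0 -ms_fin; last exact: le_lt_trans TTm.
rewrite msE// EFinD (EFinM c (fine _)) -(conv_ker_fin mf fM f_lt0)//.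
congr (_ + _ * _)%E; apply: eq_conv_ker => x xt.
have xT := le_trans (ltW xt) tT.
by rewrite /= /f xT ms_fin//; exact: le_lt_trans TTm.
Qed.

Lemma sol_equicontinuous (e : R) : 0 < e ->
  exists2 d : R, 0 < d & forall t t', 0 <= t -> t <= T -> 0 <= t' -> t' <= T ->
    `|t' - t| < d -> `|sol t' - sol t| < e.
Proof. exact: (volterra_equicontinuous al0 al1 mf fM f_lt0 solE). Qed.

Lemma sol_caputo t : 0 < t -> t < T -> {for t, continuous sol} ->
  derivable (caputo_primitive al sol) t 1 /\ caputo al sol t = sol t `^ p.
Proof.
move=> t0 tT ct.
have solf s : 0 < s -> s <= T -> sol s `^ p = f s by move=> s0 sT; rewrite /sol /f s0 sT.
rewrite solf ?ltW//; apply: (volterra_caputo al0 al1 mf fM f_lt0 solE t0 tT).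
have cp : {for t, continuous (fun s => sol s `^ p)}.
  have sol0 : \forall s \near t, 0 <= sol s.
    by near=> s; rewrite /sol; case: ifP => _; [exact: fine_ge0|exact: ltW].
  exact: (nonneg_powR_continuous p_gt0 sol0 ct).
rewrite /prop_for /continuous_at -solf ?ltW//.
apply: cvg_trans cp; apply: near_eq_cvg; near=> s.
rewrite solf//.
- by near: s; exact: lt_nbhsr.
- by apply/ltW; near: s; exact: lt_nbhsl.
Unshelve. all: by end_near. Qed.

End truncation.

Lemma sol_continuous_at (x e : R) : 0 <= x -> x < Tm -> 0 < e ->
  exists2 d : R, 0 < d &
    forall y, 0 <= y -> `|y - x| < d -> `|sol y - sol x| < e.
Proof.
move=> x0 xTm e0; pose T := (x + Tm) / 2.
have xT : x < T by rewrite midf_lt.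
have TTm : T < Tm by rewrite midf_lt.
have [d d0 H] := sol_equicontinuous TTm e0.
exists (Num.min d (T - x)); first by rewrite lt_min d0 subr_gt0.
move=> y y0; rewrite lt_min => /andP[yd yT]; apply: H => //; first exact: ltW.
by have := le_lt_trans (ler_norm _) yT; rewrite ltrD2r => /ltW.
Qed.

Lemma sol_is_solution : is_solution al p u0 Tm%:E sol.
Proof.
have Tm0 := blowup_time_gt0 u0_gt0 p_gt1 al0 al_le1 c_gt0.
split.
- by rewrite lte_fin.
- apply/subspace_continuousP => x /= [x0]; rewrite lte_fin => xTm.
  apply/cvgrPdist_lt => e e0; have [d d0 H] := sol_continuous_at x0 xTm e0.
  rewrite near_withinE; near=> y => -[y0 _].
  by rewrite distrC; apply: H => //; rewrite distrC; near: y; exact: nbhsx_ballx.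
- by move=> t _ _; rewrite /sol; case: ifP => _; [exact: fine_ge0|exact: ltW].
- by rewrite /sol ltxx.
- move=> t t0; rewrite lte_fin => tTm.
  have tT : t < (t + Tm) / 2 by rewrite midf_lt.
  have TTm : (t + Tm) / 2 < Tm by rewrite midf_lt.
  apply: (sol_caputo TTm t0 tT).
  apply/cvgrPdist_lt => e e0; have [d d0 H] := sol_continuous_at (ltW t0) tTm e0.
  near=> y; rewrite distrC; apply: H.
  + by apply/ltW; near: y; exact: lt_nbhsr.
  + by rewrite distrC; near: y; exists d => //= z.
Unshelve. all: by end_near. Qed.

(** A solution still defined at some [T > Tm] would make the minimal solution finite at [T]. *)
Lemma solution_domain S v : is_solution al p u0 S v -> (S <= Tm%:E)%E.
Proof.
have Tm0 := blowup_time_gt0 u0_gt0 p_gt1 al0 al_le1 c_gt0.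
move=> sv; rewrite leNgt; apply/negP => /lte_dense_real [T TmT TS].
have E := solution_minsol sv (lt_trans Tm0 TmT) TS.
have := lt_blowup_time u0_gt0 p_gt1 al0 al_le1 c_gt0 (t := T).
by rewrite -/ms E ltry => /(_ isT); rewrite leNgt TmT.
Qed.

Lemma solution_sol S v t : is_solution al p u0 S v -> 0 <= t -> (t%:E < S)%E ->
  v t = sol t.
Proof.
move=> sv; rewrite le_eqVlt => /predU1P[<- _|t0 tS].
  by have [_ _ _ -> _] := sv; rewrite /sol ltxx.
by rewrite /sol t0 (solution_minsol sv t0 tS).
Qed.

Lemma sol_is_the_solution : is_the_solution al p u0 Tm%:E sol.
Proof.
split.
  split; first exact: sol_is_solution.
  move=> S v TmS _ sv; have := solution_domain sv.
  by rewrite leNgt TmS.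
move=> S v [sv maxv].
(* If [S < Tm], then [sol] would be a proper prolongation of [v], against the maximality of [v]. *)
have ST : S = Tm%:E.
  apply/eqP; rewrite eq_le (solution_domain sv)/= leNgt; apply/negP => STm.
  apply: (maxv _ sol STm _ sol_is_solution) => t t0 tS.
  by rewrite (solution_sol sv).
by split => // t t0 tTm; apply: (solution_sol sv) => //; rewrite ST.
Qed.

(** Monotonicity upgrades unboundedness before [Tm] to a limit. *)
Lemma sol_blowup : sol t @[t --> Tm^'-] --> +oo.
Proof.
apply/cvgryPge => A.
have [t [t0 tTm At]] := minsol_unbounded u0_gt0 p_gt1 al0 al_le1 c_gt0 A.
near=> s; have ts : t < s by near: s; exact: nbhs_left_gt.
have sTm : s < Tm by near: s; exact: nbhs_left_lt.
rewrite /sol (lt_trans t0 ts) -lee_fin -ms_fin//.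
exact: le_trans (ltW At) (ms_mono (ltW ts)).
Unshelve. all: by end_near. Qed.

End main.

Theorem theorem2p3 (R : realType) (u0 p alpha : R) :
  0 < u0 -> 1 < p -> 0 < alpha -> alpha < 1 ->
  exists (Tm : R) (u : R -> R),
    is_the_solution alpha p u0 Tm%:E u /\
    u t @[t --> Tm^'-] --> +oo.
Proof.
move=> u0_gt0 p_gt1 al0 al1.
exists (blowup_time u0 p alpha (rl_coef alpha)), (sol u0 p alpha).
by split; [exact: sol_is_the_solution|exact: sol_blowup].
Qed.
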